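(* Let $W$ be a finite reflection group. If $w,w'\in W$ satisfy $\#\mathrm{reg}(w)=\#[e,w]$ and $\#\mathrm{reg}(w')<\#[e,w']$, then $[e,w]$ and $[e,w']$ are not isomorphic as posets.
   Context: $W$ is realised as a group generated by orthogonal reflections of $\mathbb{R}^n$ with positive roots $\Phi^+$ in bijection with the set $T$ of reflections of $W$. $[e,x]=\{u\in W:u\le x\}$ is the principal order ideal in Bruhat order (Bruhat order being the transitive closure of the relations $y<ty$ for $t\in T$ with $\ell(y)<\ell(ty)$, $\ell$ the Coxeter length). For $x\in W$ with reduced expression $x=s_1\cdots s_k$, its inversions are the reflections $s_1\cdots s_{i-1}s_is_{i-1}\cdots s_1$, $i\in[k]$ (this set does not depend on the reduced expression); the inversion arrangement $\mathcal{A}_x$ consists of the hyperplanes orthogonal to the roots of the inversions of $x$, and $\mathrm{reg}(x)$ is the set of connected components of $\mathbb{R}^n\setminus\bigcup\mathcal{A}_x$. *)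

(* Defs.v *)
From Stdlib Require Import Relation_Operators.
From HB Require Import structures.
From mathcomp Require Import all_boot all_order all_algebra.
From mathcomp Require Import all_classical all_reals all_analysis.

Set Implicit Arguments.
Unset Strict Implicit.
Unset Printing Implicit Defensive.

Import Order.TTheory GRing.Theory Num.Theory.
Import numFieldNormedType.Exports.

Local Open Scope classical_set_scope.
Local Open Scope ring_scope.

Definition card_lt (T U : Type) (A : set T) (B : set U) : Prop :=
  (A #<= B)%card /\ ~~ (B #<= A)%card.

(* Vectors of R^n are columns, so that *m is composition of maps and
   (g *m h) *m v = g *m (h *m v). *)
Section ReflectionGroups.
Context {R : realType} {n : nat}.
Implicit Types (a v : 'cV[R]_n) (g t x y : 'M[R]_n) (s : seq 'M[R]_n).
Implicit Types (W S : set 'M[R]_n) (Phi : set 'cV[R]_n).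
Implicit Types (Delta : seq 'cV[R]_n).

Definition dot a v : R := (a^T *m v) 0 0.

Definition reflmx a : 'M[R]_n := 1%:M - (2 / dot a a) *: (a *m a^T).

Lemma reflmxE a v : reflmx a *m v = v - (2 * dot a v / dot a a) *: a.
Proof.
rewrite /reflmx mulmxBl mul1mx -scalemxAl -mulmxA.
rewrite [a^T *m v]mx11_scalar mul_mx_scalar scalerA /dot.
by rewrite mulrAC.
Qed.

Definition word_in S s : Prop := forall t, t \in s -> S t.

Definition wprod s : 'M[R]_n := \big[mulmx/1%:M]_(t <- s) t.

(* Reflections are involutions, so the subgroup they generate is the set of
   their products; no inverses are needed. *)
Definition finite_reflection_group W : Prop :=
  finite_set W /\
  exists2 A : set 'cV[R]_n, ~ A 0 &
    W = [set wprod s | s in word_in (reflmx @` A)].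

Definition reflections W : set 'M[R]_n :=
  [set t | W t /\ exists2 a, a != 0 & t = reflmx a].

Definition root_system W Phi : Prop :=
  [/\ ~ Phi 0,
      forall a, Phi a -> forall c : R, Phi (c *: a) <-> c = 1 \/ c = -1,
      forall g a, W g -> Phi a -> Phi (g *m a)
    & reflections W = reflmx @` Phi].

Definition nonneg_comb Delta v : Prop :=
  exists2 c : 'I_(size Delta) -> R,
    forall i, 0 <= c i & v = \sum_i c i *: Delta`_i.

Definition simple_system Phi Delta : Prop :=
  [/\ free Delta, forall a, a \in Delta -> Phi a
    & forall a, Phi a -> nonneg_comb Delta a \/ nonneg_comb Delta (- a)].

Definition positive_roots Phi Delta : set 'cV[R]_n :=
  [set a | Phi a /\ nonneg_comb Delta a].

Definition simple_reflections Delta : set 'M[R]_n :=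
  [set reflmx a | a in [set a | a \in Delta]].

Definition expression Delta x s : Prop :=
  word_in (simple_reflections Delta) s /\ wprod s = x.

Definition reduced_expression Delta x s : Prop :=
  expression Delta x s /\
  forall s', expression Delta x s' -> (size s <= size s')%N.

(* All reduced expressions of x have the same size, so the choice made by xget
   is irrelevant; the default 0 is only used when x is not a product of simple
   reflections. *)
Definition coxeter_length Delta x : nat :=
  xget 0%N [set size s | s in reduced_expression Delta x].

Definition bruhat_step W Delta y z : Prop :=
  W y /\ exists2 t, reflections W t &
    z = t *m y /\ (coxeter_length Delta y < coxeter_length Delta z)%N.

Definition bruhat_le W Delta : 'M[R]_n -> 'M[R]_n -> Prop :=
  clos_refl_trans 'M[R]_n (bruhat_step W Delta).

Definition bruhat_ideal W Delta x : set 'M[R]_n :=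
  [set u | W u /\ bruhat_le W Delta u x].

(* With 0-based indexing: t = s_0 .. s_(i-1) s_i s_(i-1) .. s_0. *)
Definition inversions Delta x : set 'M[R]_n :=
  [set t | exists s i, [/\ reduced_expression Delta x s, (i < size s)%N
    & t = wprod (take i s) *m nth 1%:M s i *m wprod (rev (take i s))]].

Definition hyperplane a : set 'cV[R]_n := [set v | dot a v = 0].

Definition inversion_arrangement Phi Delta x : set (set 'cV[R]_n) :=
  [set hyperplane a | a in
    [set a | positive_roots Phi Delta a /\ inversions Delta x (reflmx a)]].

Definition arrangement_complement Phi Delta x : set 'cV[R]_n :=
  ~` \bigcup_(H in inversion_arrangement Phi Delta x) H.

Definition reg Phi Delta x : set (set 'cV[R]_n) :=
  [set connected_component (arrangement_complement Phi Delta x) v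
    | v in arrangement_complement Phi Delta x].

End ReflectionGroups.

Definition poset_isomorphic (T U : Type) (leT : T -> T -> Prop)
    (leU : U -> U -> Prop) (A : set T) (B : set U) : Prop :=
  exists2 f : T -> U, set_bij A B f &
    forall u v, A u -> A v -> (leT u v <-> leU (f u) (f v)).

(* Main.v *)
(** Write [N(w)] for the inversions of [w], ordered by a reduced word. By
    deletion-restriction the regions of the inversion arrangement are
    equinumerous with the subsets of [N(w)] containing no broken circuit, and by
    Carter's lemma [{t_1 < ... < t_m} |-> t_1 ... t_m w] is an injection of these
    subsets into [[e, w]]: the least [t_1] can be read off as the first inversion
    whose root lies in the space moved by [u w^-1], [u] being the image. That
    root is simple for the reflection subgroup of this space, so paths of the
    Bruhat graph can be lifted along it; this shows that the injection is onto if
    and only if every [u <= w] is joined to [w] by a directed path whose length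
    is the codimension of the fixed space of [u w^-1].

    This criterion depends on the poset only. The codimension of the fixed space
    of [x y^-1] is the undirected distance of [x] and [y] in the Bruhat graph of
    [[e, w]], because one can always descend from [x] or from [y] along a root of
    the moved space. Finally (Dyer) the edges of the Bruhat graph are determined
    by the order: an edge that is not a cover closes a dihedral crown of shorter
    edges, and conversely the ends of such a crown differ by a reflection.

    For orthogonal [x] and [y], [rdist x y] is the codimension of the fixed space
    of [x y^-1], and [inX x y] is its moved space, the column space of [x - y]. *)
From Stdlib Require Import Relation_Operators.
Require Import Defs.
From mathcomp Require Import all_boot all_order all_algebra.
From mathcomp Require Import all_classical all_reals all_analysis.
From mathcomp Require Import ring lra zify.

Set Implicit Arguments.
Unset Strict Implicit.
Unset Printing Implicit Defensive.

Import Order.TTheory GRing.Theory Num.Theory.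
Import numFieldNormedType.Exports.

Local Open Scope classical_set_scope.
Local Open Scope ring_scope.

(** * Orthogonal matrices and reflections *)

Section Orthogonal.
Context {R : realType} {n : nat}.
Implicit Types (a b v : 'cV[R]_n) (x y z g : 'M[R]_n).

Lemma dotE a b : dot a b = \sum_i a i 0 * b i 0.
Proof. by rewrite /dot mxE; apply: eq_bigr => i _; rewrite mxE. Qed.

Lemma dotC a b : dot a b = dot b a.
Proof. by rewrite !dotE; apply: eq_bigr => i _; rewrite mulrC. Qed.

Lemma dotDr a b c : dot a (b + c) = dot a b + dot a c.
Proof. by rewrite /dot mulmxDr mxE. Qed.

Lemma dotZr a k b : dot a (k *: b) = k * dot a b.
Proof. by rewrite /dot -scalemxAr mxE. Qed.

Lemma dotNr a b : dot a (- b) = - dot a b.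
Proof. by rewrite -scaleN1r dotZr mulN1r. Qed.

Lemma dotBr a b c : dot a (b - c) = dot a b - dot a c.
Proof. by rewrite dotDr dotNr. Qed.

Lemma dotDl a b c : dot (a + b) c = dot a c + dot b c.
Proof. by rewrite dotC dotDr !(dotC c). Qed.

Lemma dotZl a k b : dot (k *: a) b = k * dot a b.
Proof. by rewrite dotC dotZr (dotC b). Qed.

Lemma dotNl a b : dot (- a) b = - dot a b.
Proof. by rewrite dotC dotNr (dotC b). Qed.

Lemma dotBl a b c : dot (a - b) c = dot a c - dot b c.
Proof. by rewrite dotDl dotNl. Qed.

Lemma dot0r a : dot a 0 = 0.
Proof. by rewrite -(scale0r a) dotZr mul0r. Qed.

Lemma dot_sumr a (I : Type) (r : seq I) (F : I -> 'cV[R]_n) :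
  dot a (\sum_(i <- r) F i) = \sum_(i <- r) dot a (F i).
Proof.
elim: r => [|i r IH]; first by rewrite !big_nil dot0r.
by rewrite !big_cons dotDr IH.
Qed.

Lemma dot_mulr g a b : dot a (g *m b) = dot (g^T *m a) b.
Proof. by rewrite /dot trmx_mul trmxK mulmxA. Qed.

Lemma dot_ge0 a : 0 <= dot a a.
Proof. by rewrite dotE; apply: sumr_ge0 => i _; rewrite -expr2 sqr_ge0. Qed.

Lemma dot_gt0 a : a != 0 -> 0 < dot a a.
Proof.
move=> a0; rewrite lt_neqAle dot_ge0 andbT eq_sym; apply: contra a0.
rewrite dotE psumr_eq0 => [/allP a0|i _]; last by rewrite -expr2 sqr_ge0.
apply/eqP/matrixP => i j; rewrite (ord1 j) mxE.
by have := a0 i (mem_index_enum _); rewrite /= -expr2 sqrf_eq0 => /eqP.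
Qed.

Definition orth x := x^T *m x = 1%:M.

Lemma orthV x : orth x -> x *m x^T = 1%:M.
Proof. exact: mulmx1C. Qed.

Lemma orthK x m (A : 'M[R]_(n, m)) : orth x -> x^T *m (x *m A) = A.
Proof. by move=> xo; rewrite mulmxA xo mul1mx. Qed.

Lemma orthKV x m (A : 'M[R]_(n, m)) : orth x -> x *m (x^T *m A) = A.
Proof. by move=> xo; rewrite mulmxA orthV// mul1mx. Qed.

Lemma orth1 : orth 1%:M.
Proof. by rewrite /orth trmx1 mul1mx. Qed.

Lemma orthM x y : orth x -> orth y -> orth (x *m y).
Proof. by move=> xo yo; rewrite /orth trmx_mul -mulmxA (orthK _ xo). Qed.

Lemma orth_tr x : orth x -> orth x^T.
Proof. by move=> xo; rewrite /orth trmxK orthV. Qed.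

Lemma orth_dot x a b : orth x -> dot (x *m a) (x *m b) = dot a b.
Proof. by move=> xo; rewrite dot_mulr orthK. Qed.

Lemma reflmx_tr a : (reflmx a)^T = reflmx a.
Proof.
by rewrite /reflmx linearB /= trmx1 linearZ /= trmx_mul trmxK.
Qed.

Lemma reflmx_self a : reflmx a *m a = - a.
Proof.
have [->|a0] := eqVneq a 0; first by rewrite mulmx0 oppr0.
have ? := lt0r_neq0 (dot_gt0 a0).
by rewrite reflmxE mulfK// scaler_nat mulr2n opprD addrA subrr sub0r.
Qed.

Lemma reflmxK m a (A : 'M[R]_(n, m)) : reflmx a *m (reflmx a *m A) = A.
Proof.
rewrite mulmxA; suff -> : reflmx a *m reflmx a = 1%:M by rewrite mul1mx.
rewrite {2}/reflmx mulmxBr mulmx1 -scalemxAr mulmxA reflmx_self mulNmx.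
by rewrite scalerN opprK /reflmx subrK.
Qed.

Lemma orth_reflmx a : orth (reflmx a).
Proof. by rewrite /orth reflmx_tr -[X in _ *m X]mulmx1 reflmxK. Qed.

Lemma reflmxZ k a : k != 0 -> reflmx (k *: a) = reflmx a.
Proof.
move=> k0; have [->|a0] := eqVneq a 0; first by rewrite scaler0.
have ? := lt0r_neq0 (dot_gt0 a0).
have -> : reflmx (k *: a) = 1%:M - (2 / (k * (k * dot a a)) * (k * k)) *: (a *m a^T).
  rewrite /reflmx dotZl dotZr [(k *: a)^T]linearZ /= -scalemxAl -scalemxAr.
  by rewrite !scalerA -!mulrA.
rewrite /reflmx.
by congr (_ - _ *: _); field; apply/andP.
Qed.

Lemma reflmxN a : reflmx (- a) = reflmx a.
Proof. by rewrite -scaleN1r reflmxZ// oppr_eq0 oner_eq0. Qed.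

Lemma reflmx_conj g a : orth g -> reflmx (g *m a) = g *m reflmx a *m g^T.
Proof.
move=> go; rewrite /reflmx orth_dot// mulmxBr mulmx1 mulmxBl orthV//.
by rewrite -scalemxAr -scalemxAl trmx_mul !mulmxA.
Qed.

Lemma reflmx_inj a b : a != 0 -> b != 0 -> reflmx a = reflmx b ->
  exists2 k, k != 0 & b = k *: a.
Proof.
move=> a0 b0 ab; have := reflmx_self b; rewrite -ab reflmxE => /eqP.
rewrite subr_eq addrC -subr_eq opprK -mulr2n -scaler_nat => /eqP bE.
have bE' : b = (dot a b / dot a a) *: a.
  apply: (@scalerI _ _ 2%:R); first by rewrite pnatr_eq0.
  by rewrite bE scalerA mulrA.
exists (dot a b / dot a a) => //.
by apply: contra b0 => /eqP k0; rewrite bE' k0 scale0r.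
Qed.

(** * Moved spaces and reflection distance *)

Definition inX x y a := (a^T <= (x - y)^T)%MS.

(** For orthogonal [x] and [y] the vectors [v] form the fixed space of [x y^-1], so this is the
    orthogonality of moved and fixed space. The columns of [cokermx (x - y)^T] span the latter. *)
Lemma inXP x y a :
  reflect (forall v, x^T *m v = y^T *m v -> dot a v = 0) (inX x y a).
Proof.
apply: (iffP idP) => [/submxP[D aD] v xyv|aP].
  by rewrite /dot aD linearB /= -mulmxA mulmxBl xyv subrr mulmx0 mxE.
rewrite /inX submxE; apply/eqP/matrixP => i j; rewrite (ord1 i) [RHS]mxE.
rewrite -(aP (col j (cokermx (x - y)^T))); last first.
  apply/eqP; rewrite -subr_eq0 -mulmxBl -linearB /= colE mulmxA mulmx_coker.
  by rewrite mul0mx.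
rewrite /dot [LHS]mxE [RHS]mxE; apply: eq_bigr => k _.
by congr (_ * _); rewrite [RHS]mxE.
Qed.

Lemma inXPn x y a : ~~ inX x y a ->
  exists2 v, x^T *m v = y^T *m v & dot a v != 0.
Proof.
move=> /inXP /existsNP[v /not_implyP[xyv /eqP av]]; by exists v.
Qed.

Lemma inXD x y a b : inX x y a -> inX x y b -> inX x y (a + b).
Proof. by rewrite /inX [(a + b)^T]linearD; exact: addmx_sub. Qed.

Lemma inXZ x y k a : inX x y a -> inX x y (k *: a).
Proof. by rewrite /inX [(k *: a)^T]linearZ; exact: scalemx_sub. Qed.

Lemma inX_sym x y a : inX x y a = inX y x a.
Proof.
by apply/inXP/inXP => H v /esym /H.
Qed.

Lemma inX_id x a : inX x x a = (a == 0).
Proof. by rewrite /inX subrr trmx0 submx0 trmx_eq0. Qed.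

Definition rdist x y : nat := \rank (x - y).

Lemma rdist_sym x y : rdist x y = rdist y x.
Proof. by rewrite /rdist -opprB mxrank_opp. Qed.

Lemma rdist_eq0 x y : (rdist x y == 0%N) = (x == y).
Proof. by rewrite mxrank_eq0 subr_eq0. Qed.

Lemma rdist_triangle x y z : (rdist x z <= rdist x y + rdist y z)%N.
Proof. by rewrite /rdist -(subrKA y x (- z)); exact: mxrank_add. Qed.

Lemma rdist_reflmx_le x a : (rdist (reflmx a *m x) x <= 1)%N.
Proof.
rewrite /rdist /reflmx mulmxBl mul1mx addrAC subrr sub0r mxrank_opp -scalemxAl.
rewrite -mulmxA scalemxAr (leq_trans (mxrankM_maxl _ _))//.
exact: rank_leq_col.
Qed.

(* Carter's lemma: multiplying by a reflection whose root lies outside the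
   moved space adds that root to the moved space. *)
Lemma sub_reflmx_notin x y a b : orth x -> orth y -> ~~ inX x y a ->
  inX x y b || (b == a) -> inX (reflmx a *m x) y b.
Proof.
move=> xo yo /inXPn[e xye ae] bP; apply/inXP => v.
rewrite trmx_mul reflmx_tr -mulmxA reflmxE mulmxBr -scalemxAr => xyv.
have a0 : a != 0.
  by apply: contra ae => /eqP->; rewrite dotC dot0r.
(* Pairing the equation with [x^T *m e], which is also [y^T *m e], leaves this coefficient times
   [dot a e], which is nonzero. *)
have k0 : 2 * dot a v / dot a a = 0.
  have := congr1 (dot (x^T *m e)) xyv; rewrite dotBr dotZr {3}xye.
  rewrite !orth_dot; try exact: orth_tr.
  move=> /eqP; rewrite -subr_eq0 addrAC subrr sub0r oppr_eq0 mulf_eq0.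
  by rewrite (dotC e) (negPf ae) orbF => /eqP.
have av : dot a v = 0.
  have := lt0r_neq0 (dot_gt0 a0); move/eqP: k0; rewrite mulf_eq0 mulf_eq0.
  by rewrite pnatr_eq0 /= invr_eq0 orbC => + aa; rewrite (negPf aa) => /eqP.
case/orP: bP => [/inXP|/eqP ->//]; apply.
by move: xyv; rewrite k0 scale0r subr0.
Qed.

(** The moved space keeps its vectors and gains [a], so the rank grows; the triangle inequality
    bounds the growth by one. *)
Lemma rdist_reflmx_notin x y a : orth x -> orth y -> ~~ inX x y a ->
  rdist (reflmx a *m x) y = (rdist x y).+1.
Proof.
move=> xo yo axy; apply/eqP; rewrite eqn_leq; apply/andP; split.
  rewrite -addn1 addnC; apply: leq_trans (rdist_triangle _ x _) _.
  by rewrite leq_add2r rdist_reflmx_le.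
have sA : (((x - y)^T + a^T)%MS <= (reflmx a *m x - y)^T)%MS.
  rewrite addsmx_sub; apply/andP; split; last first.
    by apply: sub_reflmx_notin => //; rewrite eqxx orbT.
  apply/row_subP => i; rewrite -[row i _]trmxK.
  by apply: sub_reflmx_notin => //; rewrite /inX trmxK row_sub.
rewrite /rdist -[in leqRHS]mxrank_tr (leq_trans _ (mxrankS sA))//.
rewrite -[in ltnLHS]mxrank_tr.
have : ((x - y)^T < (x - y)^T + a^T)%MS.
  by rewrite /ltmx addsmxSl /= addsmx_sub submx_refl /=; exact: axy.
by rewrite ltmxErank => /andP[].
Qed.

(** Write [a = x d - y d]. As [x d] and [y d] have equal norms, the reflection takes [v = y d] to
    [x d]; so [v] is fixed for the new pair, while [dot a v] is nonzero. *)
Lemma notin_reflmx x y a : orth x -> orth y -> a != 0 -> inX x y a ->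
  ~~ inX (reflmx a *m x) y a.
Proof.
move=> xo yo a0 /submxP[D aD].
have {aD}aE : a = x *m D^T - y *m D^T.
  by rewrite -mulmxBl -[a]trmxK aD trmx_mul trmxK.
set d := D^T in aE; set v := y *m d.
have xd : x *m d = v + a by rewrite aE /v addrC subrK.
have av : 2 * dot a v = - dot a a.
  have : dot (x *m d) (x *m d) = dot (y *m d) (y *m d) by rewrite !orth_dot.
  by rewrite xd -/v dotDl !dotDr (dotC v a); lra.
have aa := lt0r_neq0 (dot_gt0 a0).
apply/negP => /inXP /(_ v); rewrite trmx_mul reflmx_tr -mulmxA reflmxE av.
rewrite mulNr divff// scaleN1r opprK -xd orthK// /v orthK// => /(_ erefl).
by move=> av0; move: av aa; rewrite av0 mulr0 => /eqP; rewrite eq_sym oppr_eq0 => ->.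
Qed.

Lemma rdist_reflmx_in x y a : orth x -> orth y -> a != 0 -> inX x y a ->
  rdist x y = (rdist (reflmx a *m x) y).+1.
Proof.
move=> xo yo a0 axy; rewrite -(@rdist_reflmx_notin _ y a) ?reflmxK//.
- by apply: orthM => //; exact: orth_reflmx.
- exact: notin_reflmx.
Qed.

Lemma sub_reflmx_in x y a b : orth x -> orth y -> a != 0 -> inX x y a ->
  inX (reflmx a *m x) y b -> inX x y b.
Proof.
move=> xo yo a0 axy bX; rewrite -(reflmxK a x); apply: sub_reflmx_notin => //.
- by apply: orthM => //; exact: orth_reflmx.
- exact: notin_reflmx.
- by rewrite bX.
Qed.

Lemma odd_rdist_reflmx x y a : orth x -> orth y -> a != 0 ->
  odd (rdist (reflmx a *m x) y) = ~~ odd (rdist x y).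
Proof.
move=> xo yo a0; have [aX|aX] := boolP (inX x y a).
  by rewrite (rdist_reflmx_in xo yo a0 aX) /= negbK.
by rewrite rdist_reflmx_notin.
Qed.

Lemma rdist_reflmx x a : orth x -> a != 0 -> rdist (reflmx a *m x) x = 1%N.
Proof.
by move=> xo a0; rewrite rdist_reflmx_notin ?inX_id// /rdist subrr mxrank0.
Qed.

(** Any nonzero column of [x - y] lies in the moved space, so reflecting in it lowers the distance
    to zero. *)
Lemma rdist1_reflmx x y : orth x -> orth y -> rdist x y = 1%N ->
  exists2 a, a != 0 & x = reflmx a *m y.
Proof.
move=> xo yo r1.
have [j a0] : exists j, col j (x - y) != 0.
  apply/existsP; apply: contra_eqT r1; rewrite negb_exists => /forallP c0.
  rewrite /rdist; suff -> : x - y = 0 by rewrite mxrank0.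
  apply/matrixP => i j; have /negPn/eqP/matrixP/(_ i 0) := c0 j.
  by rewrite !mxE.
have aX : inX x y (col j (x - y)) by rewrite /inX tr_col row_sub.
exists (col j (x - y)) => //.
move: r1; rewrite (rdist_reflmx_in xo yo a0 aX) => -[/eqP].
rewrite rdist_eq0 => /eqP E; rewrite -[LHS](reflmxK (col j (x - y))).
by congr (_ *m _).
Qed.

Lemma perturb_sign (Ls : seq 'cV[R]_n) e f : exists2 eps : R, 0 < eps &
  forall d, 0 < d -> d <= eps -> {in Ls, forall b, dot b e != 0 ->
    0 < dot b e * dot b (e + d *: f)}.
Proof.
elim: Ls => [|b Ls [eps eps0 H]]; first by exists 1; rewrite ?ltr01.
pose t := `|dot b e * dot b f|; have t0 : 0 <= t by exact: normr_ge0.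
have [be|be] := eqVneq (dot b e) 0.
  exists eps => // d d0 de c; rewrite inE => /predU1P[->|cL]; last exact: H.
  by rewrite be eqxx.
have e2 : 0 < dot b e ^+ 2 by rewrite exprn_even_gt0.
(* Up to this bound the change in [dot b e] times [dot b e] stays below [dot b e ^+ 2]; the summand
   1 keeps the denominator positive. *)
have u0 : 0 < dot b e ^+ 2 / (1 + t) by rewrite divr_gt0//; lra.
exists (Num.min eps (dot b e ^+ 2 / (1 + t))); first by rewrite lt_min eps0.
move=> d d0; rewrite le_min => /andP[de du] c.
rewrite inE => /predU1P[-> _|cL]; last exact: H.
rewrite dotDr dotZr mulrDr mulrCA -expr2.
have dt : d * t < dot b e ^+ 2.
  rewrite ler_pdivlMr in du; last lra.
  by apply: lt_le_trans du; rewrite mulrDr mulr1; lra.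
have : - (d * t) <= d * (dot b e * dot b f).
  by rewrite -mulrN ler_pM2l// lerNl /t -normrN; exact: ler_norm.
lra.
Qed.

End Orthogonal.

(** * Regions and sets without broken circuits *)

Section Regions.
Context {R : realType} {n : nat}.
Implicit Types (a b v : 'cV[R]_n) (w x y z : 'M[R]_n) (L : seq 'cV[R]_n).

(** The moved space of [y w^-1] is spanned by the roots used for [y]. If it contains [b], those
    roots include a circuit through [b] deprived of [b], so [y] itself is dropped and not only its
    product with [reflmx b]. *)
Definition nbc_step w b (S : seq 'M[R]_n) : seq 'M[R]_n :=
  flatten [seq if inX y w b then [::] else [:: y; reflmx b *m y] | y <- S].

(* The products t_1 ... t_m w over the sets {t_1 < ... < t_m} of reflections in
   L without broken circuits (circuits deprived of their least element). *)
Fixpoint nbc_products w L : seq 'M[R]_n :=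
  if L is b :: L' then nbc_step w b (nbc_products w L') else [:: w].

Lemma nbc_productsE w L : nbc_products w L = foldr (nbc_step w) [:: w] L.
Proof. by elim: L => //= b L ->. Qed.

Lemma foldr_nbc_cat w S1 S2 L : foldr (nbc_step w) (S1 ++ S2) L =
  foldr (nbc_step w) S1 L ++ foldr (nbc_step w) S2 L.
Proof. by elim: L => //= b L ->; rewrite /nbc_step map_cat flatten_cat. Qed.

(** The last root acts first, on the seed [y] alone; it leaves the seeds [y] (deletion) and
    [reflmx b *m y] (restriction), which then evolve independently. *)
Lemma size_foldr_nbc_rcons w y L b : size (foldr (nbc_step w) [:: y] (rcons L b)) =
  (if inX y w b then 0 else size (foldr (nbc_step w) [:: y] L) +
                            size (foldr (nbc_step w) [:: reflmx b *m y] L))%N.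
Proof.
rewrite foldr_rcons /nbc_step /= cats0; case: ifP => _.
  by elim: L => //= c L; rewrite /nbc_step => /size0nil ->.
by rewrite -/(nbc_step w) -[[:: y; _]]/([:: y] ++ [:: _]) foldr_nbc_cat size_cat.
Qed.

Definition sign_vector L v : seq bool := [seq 0 < dot b v | b <- L].

Definition off_hyperplanes L v : Prop := {in L, forall b, dot b v != 0}.

(** The regions cut out by [L] on the fixed space of [y w^-1], encoded by their signs. *)
Definition realized w y L (sg : seq bool) : Prop :=
  exists v, [/\ y^T *m v = w^T *m v, off_hyperplanes L v & sg = sign_vector L v].

Lemma off_hyperplanes_rcons L b v :
  off_hyperplanes (rcons L b) v <-> off_hyperplanes L v /\ dot b v != 0.
Proof.
split=> [H|[H1 H2] c]; last by rewrite mem_rcons inE => /predU1P[->|/H1].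
by split=> [c cL|]; apply: H; rewrite mem_rcons inE ?cL ?eqxx ?orbT.
Qed.

Lemma sign_vector_rcons L b v :
  sign_vector (rcons L b) v = rcons (sign_vector L v) (0 < dot b v).
Proof. by rewrite /sign_vector map_rcons. Qed.

Lemma same_sign (s t : R) : 0 < s * t -> t != 0 /\ (0 < s) = (0 < t).
Proof.
move=> st; have [s0|s0|s0] := ltgtP s 0.
- by rewrite nmulr_rgt0// in st; rewrite lt_eqF// lt_gtF.
- by rewrite pmulr_rgt0// in st; rewrite gt_eqF.
- by rewrite s0 mul0r ltxx in st.
Qed.

Lemma same_sign_vector L u v : {in L, forall b, 0 < dot b u * dot b v} ->
  off_hyperplanes L v /\ sign_vector L u = sign_vector L v.
Proof.
move=> H; split=> [b /H/same_sign[]//|].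
by apply/eq_in_map => b /H/same_sign[].
Qed.

(* Deletion-restriction at the largest hyperplane: both sides satisfy the same
   recursion, restricting to the fixed space of y w^-1. *)
Lemma realized_seq w L y : orth w -> orth y ->
  exists ss : seq (seq bool), [/\ uniq ss,
    size ss = size (foldr (nbc_step w) [:: y] L)
    & forall sg, sg \in ss <-> realized w y L sg].
Proof.
move=> wo; elim/last_ind: L y => [|L b IH] y yo.
  exists [:: [::]]; split=> // sg; rewrite inE; split=> [/eqP ->|[v [_ _ ->]]//].
  by exists 0; split=> //; rewrite !mulmx0.
rewrite size_foldr_nbc_rcons; case: ifPn => yb.
  exists [::]; split=> // sg; split=> // -[v [yv /off_hyperplanes_rcons[_ bv] _]].
  by move/inXP: yb => /(_ v yv)/eqP; rewrite (negPf bv).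
have [ss1 [u1 s1 ss1P]] := IH y yo.
have [|ss2 [u2 s2 ss2P]] := IH (reflmx b *m y).
  by apply: orthM => //; exact: orth_reflmx.
have [f yf bf] := inXPn yb.
(* [ss1] lists the regions before the hyperplane of [b] is added, and [p t] selects those meeting
   its side [t]. The regions meeting both sides are those that the hyperplane cuts, listed by
   [ss2]. *)
pose p t sg := `[< exists v, [/\ y^T *m v = w^T *m v, off_hyperplanes L v,
  sg = sign_vector L v, dot b v != 0 & (0 < dot b v) = t] >].
have fixE v : (reflmx b *m y)^T *m v = w^T *m v <->
    y^T *m v = w^T *m v /\ dot b v = 0.
  rewrite trmx_mul reflmx_tr -mulmxA; split=> [E|[E bv]]; last first.
    by rewrite reflmxE bv mulr0 mul0r scale0r subr0.
  have bv : dot b v = 0.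
    have /inXP : inX (reflmx b *m y) w b.
      by apply: sub_reflmx_notin => //; rewrite eqxx orbT.
    by apply; rewrite trmx_mul reflmx_tr -mulmxA.
  by rewrite -E reflmxE bv mulr0 mul0r scale0r subr0.
(* A point on the hyperplane of [b] can be pushed to the side of [g] without changing the other
   signs. *)
have pert v g : y^T *m v = w^T *m v -> y^T *m g = w^T *m g -> dot b v = 0 ->
    dot b g != 0 -> off_hyperplanes L v -> p (0 < dot b g) (sign_vector L v).
  move=> yv yg bv bg vL; have [eps e0 /(_ eps e0 (lexx _)) H] := perturb_sign L v g.
  have [|vgL sE] := @same_sign_vector L v (v + eps *: g).
    by move=> c cL; apply: H => //; exact: vL.
  apply/asboolP; exists (v + eps *: g); split=> //.
  - by rewrite !mulmxDr -!scalemxAr yv yg.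
  - by rewrite dotDr dotZr bv add0r mulf_neq0// gt_eqF.
  - by rewrite dotDr dotZr bv add0r pmulr_rgt0.
have p1 sg : sg \in ss1 -> p true sg || p false sg.
  move=> /ss1P[v [yv vL ->]]; have [bv|bv] := eqVneq (dot b v) 0.
    by have := pert v f yv yf bv bf vL; case: (0 < _) => ->; rewrite ?orbT.
  suff : p (0 < dot b v) (sign_vector L v) by case: (0 < _) => ->; rewrite ?orbT.
  by apply/asboolP; exists v.
have p2 sg : sg \in ss2 <-> p true sg && p false sg.
  split=> [/ss2P[v [/fixE[yv bv] vL ->]]|/andP[/asboolP[v1 [y1 L1 -> b1 h1]]]].
    have H1 := pert v f yv yf bv bf vL.
    have H2 : p (0 < dot b (- f)) (sign_vector L v).
      by apply: pert => //; rewrite ?mulmxN ?yf// dotNr oppr_eq0.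
    move: H1 H2; rewrite dotNr oppr_gt0; case: (ltgtP (dot b f) 0) bf => // _ _;
    by move=> -> ->.
  move=> /asboolP[v2 [y2 L2 sE b2 h2]]; apply/ss2P.
  have {}h2 : dot b v2 < 0 by rewrite lt_neqAle b2 leNgt h2.
  (* Up to a positive factor, the point where the segment from [v1] to [v2] crosses the hyperplane
     of [b]; both coefficients are positive. *)
  exists (- dot b v2 *: v1 + dot b v1 *: v2).
  have same c : c \in L ->
      0 < dot c v1 * dot c (- dot b v2 *: v1 + dot b v1 *: v2).
    move=> cL; have /(congr1 (fun s => nth false s (index c L))) := sE.
    rewrite /sign_vector !(nth_map 0) ?index_mem// !nth_index// => sc.
    have := L1 c cL; have := L2 c cL; rewrite dotDr !dotZr.
    case: (ltgtP (dot c v1) 0) sc => // c1; case: (ltgtP (dot c v2) 0) => // c2 _ _ _.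
      by rewrite nmulr_rgt0//; nra.
    by rewrite pmulr_rgt0//; nra.
  have [oL sE'] := same_sign_vector same; split=> //.
  apply/fixE; split; first by rewrite !mulmxDr -!scalemxAr y1 y2.
  by rewrite dotDr !dotZr; ring.
exists ([seq rcons sg true | sg <- ss1 & p true sg] ++
        [seq rcons sg false | sg <- ss1 & p false sg]); split.
- have rinj t : injective (rcons^~ t : seq bool -> seq bool) by exact: rcons_injl.
  rewrite cat_uniq !map_inj_uniq// !filter_uniq//= andbT.
  apply/hasPn => sg /mapP[s _ ->]; apply/mapP => -[s' _ /eqP].
  by rewrite eqseq_rcons andbF.
(* Inclusion-exclusion: every old region meets some side, and those meeting both are counted
   twice. *)
- rewrite size_cat !size_map !size_filter -count_predUI -s1 -s2; congr (_ + _)%N.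
    by rewrite -[RHS](count_predT); apply: eq_in_count => sg /p1 /=.
  rewrite -size_filter; apply/perm_size/uniq_perm; rewrite ?filter_uniq// => sg.
  rewrite mem_filter /=; apply/andP/idP => [[/p2]//|sg2]; split; first exact/p2.
  apply/ss1P; move/ss2P: sg2 => [v [/fixE[yv _] vL ->]]; by exists v.
move=> sg; rewrite mem_cat; split.
  move=> /orP[]/mapP[s]; rewrite mem_filter => /andP[/asboolP[v [yv vL -> bv h]] _] ->;
  by exists v; split; rewrite ?sign_vector_rcons ?h//; apply/off_hyperplanes_rcons.
move=> [v [yv /off_hyperplanes_rcons[vL bv] ->]]; rewrite sign_vector_rcons.
have vs : sign_vector L v \in ss1 by apply/ss1P; exists v.
have : p (0 < dot b v) (sign_vector L v) by apply/asboolP; exists v.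
by case: (0 < _) => pv; apply/orP; [left|right]; apply/map_f; rewrite mem_filter pv.
Qed.

(** * Connected components and sign vectors *)

Lemma dot_continuous b : continuous (dot b : 'cV[R]_n -> R).
Proof.
have -> : dot b = (fun v : 'cV[R]_n => \sum_i b i 0 * v i 0).
  by apply/funext => v; rewrite dotE.
elim: (index_enum _) => [|i r IH].
  under eq_fun do rewrite big_nil; exact: cst_continuous.
under eq_fun do rewrite big_cons.
move=> v; apply: (@continuousD _ _ _ (fun u : 'cV[R]_n => b i 0 * u i 0)).
  by apply: continuousM; [exact: cst_continuous | exact: coord_continuous].
exact: IH.
Qed.

Lemma connected_sign (C : set 'cV[R]_n) b u v : connected C -> C u -> C v ->
  (forall z : 'cV[R]_n, C z -> dot b z != 0) -> (0 < dot b u) = (0 < dot b v).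
Proof.
move=> cC Cu Cv C0.
have /connected_intervalP itv : connected (dot b @` C).
  apply: connected_continuous_connected => //; apply: continuous_subspaceT.
  exact: dot_continuous.
have no0 (x y : 'cV[R]_n) : C x -> C y -> dot b x < 0 -> 0 < dot b y -> False.
  move=> Cx Cy xb yb; have [|||z Cz z0] := itv (dot b x) (dot b y) _ _ 0.
  - by exists x.
  - by exists y.
  - by rewrite !ltW.
  by have := C0 z Cz; rewrite z0 eqxx.
have := C0 u Cu; have := C0 v Cv.
case: (ltgtP (dot b u) 0) => // ub; case: (ltgtP (dot b v) 0) => // vb _ _.
  by case: (no0 u v).
by case: (no0 v u).
Qed.

(** No dot product with a member of [L] can change sign on a connected set avoiding the hyperplanes;
    conversely a sign class is convex, so the segment from [u] to [v] joins them. *)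
Lemma connected_component_sign L u v : off_hyperplanes L u -> off_hyperplanes L v ->
  connected_component (off_hyperplanes L) u v <-> sign_vector L u = sign_vector L v.
Proof.
move=> uL vL; split.
  move=> [C [Cu CL cC] Cv]; apply/eq_in_map => b bL.
  by apply: (connected_sign cC) => // x /CL; apply.
move=> sE; pose g (t : R) := u + t *: (v - u).
have H : g @` `[0, 1] `<=` connected_component (off_hyperplanes L) u.
  apply: connected_component_max.
  - by exists 0; rewrite /g ?scale0r ?addr0//= in_itv /= lexx ler01.
  - move=> _ [t /= + <-] b bL; rewrite in_itv /= => /andP[t0 t1].
    have /(congr1 (fun s => nth false s (index b L))) := sE.
    rewrite /sign_vector !(nth_map 0) ?index_mem// !nth_index// => sb.
    have := uL b bL; have := vL b bL; rewrite /g dotDr dotZr dotBr.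
    case: (ltgtP (dot b u) 0) sb => // ub; case: (ltgtP (dot b v) 0) => // vb _ _ _.
      by rewrite lt_eqF//; nra.
    by rewrite gt_eqF//; nra.
  - apply: connected_continuous_connected; first exact: segment_connected.
    apply: continuous_subspaceT => t; apply: cvgD; first exact: cvg_cst.
    by apply: cvgZr_tmp; exact: cvg_id.
apply: H; exists 1; first by rewrite /= in_itv /= lexx ler01.
by rewrite /g scale1r addrC subrK.
Qed.

(** For [y = w] the fixed space is everything, so the deletion-restriction count is that of all
    regions. *)
Lemma card_components w L : orth w ->
  ([set connected_component (off_hyperplanes L) v | v in off_hyperplanes L]
     #= `I_(size (nbc_products w L)))%card.
Proof.
move=> wo; have [ss [us sz ssP]] := realized_seq L wo wo.
rewrite nbc_productsE -sz.
have ssP' sg : sg \in ss -> exists v, off_hyperplanes L v /\ sg = sign_vector L v.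
  by move=> /ssP[v [_ vL ->]]; exists v.
(* A chosen point in the region with signs [sg]; the default 0 is never reached for [sg] in [ss]. *)
pose c sg := xget 0 [set v | off_hyperplanes L v /\ sg = sign_vector L v].
have cP sg : sg \in ss -> off_hyperplanes L (c sg) /\ sg = sign_vector L (c sg).
  move=> /ssP'[v vP].
  suff : [set v | off_hyperplanes L v /\ sg = sign_vector L v] (c sg) by [].
  by apply: xgetPex; exists v.
pose h i := connected_component (off_hyperplanes L) (c (nth [::] ss i)).
have -> : [set connected_component (off_hyperplanes L) v | v in off_hyperplanes L] =
    h @` `I_(size ss).
  apply/seteqP; split=> [_ [v vL <-]|_ [i /= iss <-]]; last first.
    by exists (c (nth [::] ss i)) => //; have [] := cP _ (mem_nth [::] iss).
  have vss : sign_vector L v \in ss by apply/ssP; exists v.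
  exists (index (sign_vector L v) ss); first by rewrite /= index_mem.
  rewrite /h nth_index//; have [cL cE] := cP _ vss.
  by apply: same_connected_component; apply/connected_component_sign.
apply: inj_card_eq => i j; rewrite !inE /= => iss jss hij.
have [ciL ciE] := cP _ (mem_nth [::] iss); have [cjL cjE] := cP _ (mem_nth [::] jss).
apply/eqP; rewrite -(nth_uniq [::] iss jss us) ciE cjE; apply/eqP.
apply/connected_component_sign => //.
have : connected_component (off_hyperplanes L) (c (nth [::] ss j)) (c (nth [::] ss j)).
  exact: connected_component_refl.
by rewrite -/(h j) -hij.
Qed.

End Regions.

(** * Counting in lists and finite sets *)

Lemma count_ltn (T : eqType) (p q : pred T) (s : seq T) x :
  {in s, forall y, p y -> q y} -> x \in s -> q x -> ~~ p x ->
  (count p s < count q s)%N.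
Proof.
move=> pq xs qx px; have -> : count p s = count (predI p q) s.
  by apply: eq_in_count => y /pq /=; case: (p y) => // ->.
have -> : count q s = (count (predI p q) s + count (predI (predC p) q) s)%N.
  by elim: (s) => //= y t ->; case: (p y); case: (q y) => //=; lia.
rewrite -addn1 leq_add2l -has_count; apply/hasP; exists x => //=.
by rewrite px.
Qed.

Lemma count_disjointU (T : eqType) (p q r : pred T) (s : seq T) :
  {in s, forall x, p x = q x || r x} -> {in s, forall x, q x -> ~~ r x} ->
  count p s = (count q s + count r s)%N.
Proof.
elim: s => //= x s IH pqr qr; rewrite IH; last 2 first.
- by move=> y ys; apply: pqr; rewrite inE ys orbT.
- by move=> y ys; apply: qr; rewrite inE ys orbT.
have := qr x (mem_head _ _); rewrite pqr ?mem_head//.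
by case: (q x); case: (r x) => //= H; try lia; have := H isT.
Qed.

Lemma seq_argmax (R : realType) (T : eqType) (f : T -> R) (s : seq T) x : x \in s ->
  exists2 y, y \in s & {in s, forall z, f z <= f y}.
Proof.
elim: s x => [//|a s IH] x _; case: s => [|b s] in IH *.
  by exists a; [rewrite mem_head | move=> z; rewrite inE => /eqP ->].
have [y ys ymax] := IH b (mem_head _ _).
have [fa|fa] := leP (f a) (f y).
  exists y; first by rewrite inE ys orbT.
  by move=> z; rewrite inE => /predU1P[->|/ymax].
exists a; first by rewrite mem_head.
by move=> z; rewrite inE => /predU1P[->//|/ymax/le_trans->//]; exact: ltW.
Qed.

Lemma set_bij_inverse (T : pointedType) (U : Type) (A : set T) (B : set U) f :
  set_bij A B f -> exists2 g, set_bij B A g & forall u, B u -> f (g u) = u.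
Proof.
move=> [fAB finj fsurj]; pose g u := xget point [set x | A x /\ f x = u].
have gP u : B u -> A (g u) /\ f (g u) = u.
  move=> /fsurj[x Ax xu].
  suff : [set x | A x /\ f x = u] (g u) by [].
  by apply: xgetPex; exists x.
exists g => [|u /gP[]//]; split=> [u /gP[]//|u v|x Ax].
  by rewrite !inE => /gP[_ {2}<-] /gP[_ {2}<-] ->.
have Bfx := fAB x Ax; have [gA gE] := gP _ Bfx.
by exists (f x) => //; apply: finj; rewrite ?inE.
Qed.

Lemma card_seq_set (T : eqType) (x0 : T) (s : seq T) : uniq s ->
  ([set` s] #= `I_(size s))%card.
Proof.
move=> us; have -> : [set` s] = nth x0 s @` `I_(size s).
  apply/seteqP; split=> [x /= xs|_ [i /= ilt <-]]; last exact: mem_nth.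
  by exists (index x s); rewrite /= ?index_mem ?nth_index.
apply: inj_card_eq => i j; rewrite !inE /= => ilt jlt /eqP.
by rewrite nth_uniq// => /eqP.
Qed.

(** * Words in reflections and dual vectors *)

Section Words.
Context {R : realType} {n : nat}.
Implicit Types (a b v : 'cV[R]_n) (x y z g : 'M[R]_n).
Implicit Types (s : seq 'M[R]_n) (r : seq 'cV[R]_n).

Definition rword r : 'M[R]_n := wprod (map reflmx r).

Lemma wprod_cons t s : wprod (t :: s) = t *m wprod s.
Proof. by rewrite /wprod big_cons. Qed.

Lemma wprod_cat s1 s2 : wprod (s1 ++ s2) = wprod s1 *m wprod s2.
Proof.
elim: s1 => [|t s1 IH] /=; first by rewrite /wprod big_nil mul1mx.
by rewrite !wprod_cons IH mulmxA.
Qed.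

Lemma rword_nil : rword [::] = 1%:M.
Proof. by rewrite /rword /wprod big_nil. Qed.

Lemma rword_cons a r : rword (a :: r) = reflmx a *m rword r.
Proof. by rewrite /rword /= wprod_cons. Qed.

Lemma rword_cat r1 r2 : rword (r1 ++ r2) = rword r1 *m rword r2.
Proof. by rewrite /rword map_cat wprod_cat. Qed.

Lemma rword_rev r : rword (rev r) = (rword r)^T.
Proof.
elim: r => [|a r IH]; first by rewrite rword_nil trmx1.
by rewrite rev_cons -cats1 rword_cat IH !rword_cons rword_nil mulmx1 trmx_mul reflmx_tr.
Qed.

Lemma orth_rword r : orth (rword r).
Proof.
elim: r => [|a r IH]; first by rewrite rword_nil; exact: orth1.
by rewrite rword_cons; apply: orthM => //; exact: orth_reflmx.
Qed.

Lemma word_in_map (A : set 'cV[R]_n) s : word_in (reflmx @` A) s ->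
  exists2 r, s = map reflmx r & {in r, forall a, A a}.
Proof.
elim: s => [|t s IH] sA; first by exists [::].
have [a Aa at_] := sA t (mem_head _ _).
have [|r -> rA] := IH; first by move=> u us; apply: sA; rewrite inE us orbT.
exists (a :: r); first by rewrite /= at_.
by move=> b; rewrite inE => /predU1P[->//|/rA].
Qed.

Lemma map_word_in (A : set 'cV[R]_n) r : {in r, forall a, A a} ->
  word_in (reflmx @` A) (map reflmx r).
Proof. by move=> rA t /mapP[a /rA Aa ->]; exists a. Qed.

Lemma odd_rdist_rword r y z : orth y -> orth z -> {in r, forall a, a != 0} ->
  odd (rdist (rword r *m y) z) = odd (size r) (+) odd (rdist y z).
Proof.
move=> yo zo; elim: r => [|a r IH] r0; first by rewrite rword_nil mul1mx.
rewrite rword_cons -mulmxA odd_rdist_reflmx//.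
- by rewrite IH ?addNb// => b br; apply: r0; rewrite inE br orbT.
- by apply: orthM => //; exact: orth_rword.
- by apply: r0; rewrite mem_head.
Qed.

(** The coordinates over the free family extend the prescribed values to a linear form, and [l] has
    as entries the values of this form on the standard basis. *)
Lemma free_dual (X : seq 'cV[R]_n) (f : 'cV[R]_n -> R) : free X ->
  exists l, forall a, a \in X -> dot l a = f a.
Proof.
move=> fX; pose c i v := coord (in_tuple X) i v.
pose F v := \sum_(i < size X) f X`_i * c i v.
exists (\col_j F (delta_mx j 0)) => a aX.
have -> : dot (\col_j F (delta_mx j 0)) a = F a.
  have {2}-> : a = \sum_j a j 0 *: delta_mx j 0.
    by rewrite {1}(matrix_sum_delta a); apply: eq_bigr => j _; rewrite big_ord1.
  rewrite dotE /F; under eq_bigr do rewrite mxE mulr_suml.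
  rewrite exchange_big /=; apply: eq_bigr => i _.
  rewrite /c linear_sum mulr_sumr; apply: eq_bigr => j _.
  by rewrite linearZ /= -mulrA; congr (_ * _); rewrite mulrC.
have ia : (index a X < size X)%N by rewrite index_mem.
pose i := Ordinal ia.
have aE : a = X`_i by rewrite /= nth_index.
have ca j : c j a = (j == i)%:R by rewrite aE eq_sym; exact: coord_free.
rewrite /F (bigD1 i)//= big1 => [|j ji]; last by rewrite ca (negPf ji) mulr0.
by rewrite ca eqxx mulr1 addr0 nth_index.
Qed.

End Words.

(** * Root systems and lengths *)

Section Roots.
Context {R : realType} {n : nat} {W : set 'M[R]_n} {Phi : set 'cV[R]_n}.
Context {Delta : seq 'cV[R]_n}.
Context (hW : finite_reflection_group W) (hPhi : root_system W Phi).
Context (hDelta : simple_system Phi Delta).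
Implicit Types (a b v : 'cV[R]_n) (x y z g : 'M[R]_n).

Lemma root_neq0 a : Phi a -> a != 0.
Proof. by move=> Pa; apply/eqP => a0; case: hPhi => + _ _ _; rewrite -a0; apply. Qed.

Lemma rootN a : Phi a -> Phi (- a).
Proof.
move=> Pa; case: hPhi => _ /(_ a Pa (-1)) [_ H] _ _.
by rewrite -scaleN1r; apply: H; right.
Qed.

Lemma rootZ a k : Phi a -> Phi (k *: a) -> k *: a = a \/ k *: a = - a.
Proof.
move=> Pa; case: hPhi => _ /(_ a Pa k) [H _] _ _ /H[->|->].
  by left; rewrite scale1r.
by right; rewrite scaleN1r.
Qed.

(** The given generators are reflections belonging to [W], hence reflections in roots; conversely
    reflections in roots belong to [W]. *)
Lemma groupP x : W x <-> exists2 r, x = rword r & {in r, forall a, Phi a}.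
Proof.
have W1 t A : ~ A 0 -> W = [set wprod s | s in word_in (reflmx @` A)] ->
    A t -> W (reflmx t).
  move=> A0 -> At; exists [:: reflmx t]; last by rewrite wprod_cons /wprod big_nil mulmx1.
  by move=> u; rewrite inE => /eqP ->; exists t.
case: hW => _ [A A0 WE]; split.
  move=> Wx; move: (Wx); rewrite {1}WE => -[s sA <-].
  have AP : reflmx @` A `<=` reflmx @` Phi.
    move=> _ [t At <-]; case: hPhi => _ _ _ <-; split; first exact: (W1 t A).
    by exists t => //; apply/eqP => t0; apply: A0; rewrite -t0.
  have /word_in_map[r -> rP] : word_in (reflmx @` Phi) s by move=> t /sA/AP.
  by exists r.
move=> [r -> rP].
have WP a : Phi a -> W (reflmx a).
  by move=> Pa; case: hPhi => _ _ _ H; have : (reflmx @` Phi) (reflmx a);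
    [exists a | rewrite -H => -[]].
rewrite WE; elim: r rP => [|a r IH] rP.
  by exists [::]; [move=> t | rewrite rword_nil /wprod big_nil].
have [|s1 s1A s1E] := IH; first by move=> b br; apply: rP; rewrite inE br orbT.
have : W (reflmx a) by apply/WP/rP; rewrite mem_head.
rewrite WE => -[s2 s2A s2E].
exists (s2 ++ s1); last by rewrite wprod_cat s2E s1E rword_cons.
by move=> t; rewrite mem_cat => /orP[/s2A|/s1A].
Qed.

Lemma groupM x y : W x -> W y -> W (x *m y).
Proof.
move=> /groupP[r1 -> r1P] /groupP[r2 -> r2P]; apply/groupP.
exists (r1 ++ r2); first by rewrite rword_cat.
by move=> a; rewrite mem_cat => /orP[/r1P|/r2P].
Qed.

Lemma group_tr x : W x -> W x^T.
Proof.
move=> /groupP[r -> rP]; apply/groupP; exists (rev r); first by rewrite rword_rev.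
by move=> a; rewrite mem_rev => /rP.
Qed.

Lemma group_reflmx a : Phi a -> W (reflmx a).
Proof.
move=> Pa; apply/groupP; exists [:: a]; first by rewrite rword_cons rword_nil mulmx1.
by move=> b; rewrite inE => /eqP ->.
Qed.

Lemma group_orth x : W x -> orth x.
Proof. by move=> /groupP[r -> _]; exact: orth_rword. Qed.

Lemma root_mul x a : W x -> Phi a -> Phi (x *m a).
Proof. by case: hPhi => _ _ + _ Wx Pa; apply. Qed.

Lemma root_reflmx a b : Phi a -> Phi b -> Phi (reflmx a *m b).
Proof. by move=> Pa; apply: root_mul; exact: group_reflmx. Qed.

Lemma root_reflmx_inj a b : Phi a -> Phi b -> reflmx a = reflmx b ->
  b = a \/ b = - a.
Proof.
move=> Pa Pb /reflmx_inj[||k _ bE]; try exact: root_neq0.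
by rewrite bE; apply: rootZ => //; rewrite -bE.
Qed.

Lemma reflection_root t : reflections W t -> exists2 a, Phi a & t = reflmx a.
Proof. by case: hPhi => _ _ _ -> [a Pa <-]; exists a. Qed.

(** Each reflection changes the parity of the distance, so this parity plays the role of the
    determinant of [x y^-1]. *)
Lemma odd_rdist x y z : W x -> W y -> W z ->
  odd (rdist x z) = odd (rdist x y) (+) odd (rdist y z).
Proof.
move=> Wx Wy Wz; have /groupP[r rE rP] := groupM Wx (group_tr Wy).
have -> : x = rword r *m y.
  by rewrite -rE -mulmxA group_orth// mulmx1.
have [yo zo] := (group_orth Wy, group_orth Wz).
rewrite !odd_rdist_rword//; try by move=> a /rP/root_neq0.
by rewrite /rdist subrr mxrank0 /= addbF.
Qed.

Lemma rdist1_root x y : W x -> W y -> rdist x y = 1%N ->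
  exists2 a, Phi a & x = reflmx a *m y.
Proof.
move=> Wx Wy /rdist1_reflmx[||a a0 xE]; try exact: group_orth.
have [|b Pb ab] := @reflection_root (reflmx a); last by exists b; rewrite // -ab.
split; last by exists a.
suff -> : reflmx a = x *m y^T by apply: groupM => //; exact: group_tr.
by rewrite xE -mulmxA orthV ?mulmx1//; exact: group_orth.
Qed.

Lemma simple_root a : a \in Delta -> Phi a.
Proof. by case: hDelta => _ + _; apply. Qed.

(** The dot product with [l] is the height of a root, the sum of its coefficients; its sign decides
    positivity. *)
Lemma height_exists : exists l, forall a, a \in Delta -> dot l a = 1.
Proof. by case: hDelta => fD _ _; exact: (free_dual (fun=> 1) fD). Qed.

(** There are finitely many reflections in [W], and each has only two roots, opposite to each
    other. *)
Lemma finite_roots : finite_set Phi.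
Proof.
pose T := reflections W; pose c t := xget 0 [set a | Phi a /\ reflmx a = t].
have fT : finite_set T by case: hW => fW _; apply: sub_finite_set fW => t [].
apply: (@sub_finite_set _ _ (c @` T `|` [set - a | a in c @` T])); last first.
  by rewrite finite_setU; split; do ?apply: finite_image.
move=> a Pa; have Ta : T (reflmx a).
  by rewrite /T; case: hPhi => _ _ _ ->; exists a.
have : [set b | Phi b /\ reflmx b = reflmx a] (c (reflmx a)).
  by apply: xgetPex; exists a.
move=> [Pc /root_reflmx_inj[]// ->]; first by left; exists (reflmx a).
by right; exists (c (reflmx a)) => //; exists (reflmx a).
Qed.

Lemma nonneg_comb_dot v l : nonneg_comb Delta v ->
  {in Delta, forall a, 0 <= dot l a} -> 0 <= dot l v.
Proof.
move=> [c c0 ->] l0; rewrite dot_sumr; apply: sumr_ge0 => i _.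
by rewrite dotZr mulr_ge0// l0 ?mem_nth.
Qed.

Lemma simple_exists_lt0 v l : nonneg_comb Delta v -> dot l v < 0 ->
  exists2 a, a \in Delta & dot l a < 0.
Proof.
move=> vP; apply: contraPP => H; apply/negP; rewrite -leNgt.
apply: nonneg_comb_dot vP _ => a aD; rewrite leNgt; apply/negP => la.
by apply: H; exists a.
Qed.

Section Height.
Context {l0 : 'cV[R]_n} (hl0 : forall a, a \in Delta -> dot l0 a = 1).
Local Notation ht := (dot l0).

Lemma nonneg_comb_ht v : nonneg_comb Delta v -> v != 0 -> 0 < ht v.
Proof.
move=> vP v0; rewrite lt_neqAle; apply/andP; split; last first.
  by apply: nonneg_comb_dot vP _ => a /hl0 ->; exact: ler01.
case: vP v0 => c c0 -> v0; rewrite eq_sym; apply: contra v0.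
rewrite dot_sumr psumr_eq0 => [/allP cz|i _]; last first.
  by rewrite dotZr hl0 ?mem_nth// mulr1.
apply/eqP; apply: big1 => i _; have := cz i (mem_index_enum _).
by rewrite dotZr hl0 ?mem_nth// mulr1 /= => /eqP ->; rewrite scale0r.
Qed.

Lemma ht_neq0 a : Phi a -> ht a != 0.
Proof.
move=> Pa; have a0 := root_neq0 Pa; case: hDelta => _ _ /(_ a Pa)[]aP.
  by rewrite gt_eqF// nonneg_comb_ht.
by rewrite -oppr_eq0 -dotNr gt_eqF// nonneg_comb_ht// oppr_eq0.
Qed.

Lemma ht_le0 a : Phi a -> (ht a <= 0) = (ht a < 0).
Proof. by move=> /ht_neq0 a0; rewrite le_eqVlt (negPf a0). Qed.

Lemma ht_ltNge a : Phi a -> (ht a < 0) = ~~ (0 < ht a).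
Proof. by move=> Pa; rewrite -ht_le0// leNgt. Qed.

Lemma ht_gt0P a : Phi a -> 0 < ht a -> nonneg_comb Delta a.
Proof.
move=> Pa ha; case: hDelta => _ _ /(_ a Pa)[]// aP.
have := @nonneg_comb_ht _ aP; rewrite oppr_eq0 dotNr => /(_ (root_neq0 Pa)).
by rewrite oppr_gt0 ltNge ltW.
Qed.

Lemma positive_rootsP a : positive_roots Phi Delta a <-> Phi a /\ 0 < ht a.
Proof.
split=> [[Pa aP]|[Pa ha]]; split=> //.
  by apply: nonneg_comb_ht => //; exact: root_neq0.
exact: ht_gt0P.
Qed.

Lemma simple_ht_gt0 a : a \in Delta -> 0 < ht a.
Proof. by move=> /hl0 ->; exact: ltr01. Qed.

(* The functional vanishing at a and equal to 1 at the other simple roots is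
   unchanged by the reflection in a and positive at b. *)
Lemma simple_reflmx_gt0 a b : a \in Delta -> Phi b -> 0 < ht b -> b != a ->
  0 < ht (reflmx a *m b).
Proof.
move=> aD Pb hb ba; have Pa := simple_root aD.
have Psb : Phi (reflmx a *m b) by exact: root_reflmx.
case: hDelta => fD _ _.
have [l lE] := free_dual (fun v => if v == a then 0 else 1) fD.
have la : dot l a = 0 by rewrite lE// eqxx.
have lD : {in Delta, forall c, 0 <= dot l c}.
  by move=> c /lE ->; case: ifP => // _; exact: ler01.
(* If this vanished, [b] would be a multiple of [a], hence [a] or [- a]. *)
have lb : 0 < dot l b.
  have bP := ht_gt0P Pb hb; rewrite lt_neqAle nonneg_comb_dot// andbT eq_sym.
  apply: contra ba; case: bP => c c0 bE.
  rewrite {1}bE dot_sumr psumr_eq0 => [/allP cz|i _]; last first.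
    by rewrite dotZr mulr_ge0// lD ?mem_nth.
  have bK : b = (\sum_(i < size Delta | Delta`_i == a) c i) *: a.
    rewrite scaler_suml bE [RHS]big_mkcond; apply: eq_bigr => i _.
    have := cz i (mem_index_enum _); rewrite dotZr lE ?mem_nth//=.
    have [->|/eqP/negPf E] := pselect (Delta`_i = a); first by rewrite eqxx.
    by rewrite !E mulr1 => /eqP ->; rewrite scale0r.
  have /orP[//|/eqP bN] : (b == a) || (b == - a).
    by rewrite bK in Pb *; case: (rootZ Pa Pb) => ->; rewrite eqxx ?orbT.
  by move: hb; rewrite bN dotNr oppr_gt0 ltNge ltW// simple_ht_gt0.
rewrite ltNge ht_le0//; apply/negP => hs.
have := nonneg_comb_ht; have : nonneg_comb Delta (- (reflmx a *m b)).
  by apply: ht_gt0P; [exact: rootN | rewrite dotNr oppr_gt0].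
move=> /nonneg_comb_dot/(_ lD); rewrite dotNr oppr_ge0 reflmxE dotBr dotZr la.
by rewrite mulr0 subr0 leNgt lb.
Qed.

Lemma positive_roots_seq :
  exists2 P : seq 'cV[R]_n, uniq P & forall a, a \in P <-> Phi a /\ 0 < ht a.
Proof.
have /finite_seqP[s sE] := finite_roots.
exists (undup [seq a <- s | 0 < ht a]); first exact: undup_uniq.
move=> a; rewrite mem_undup mem_filter; have -> : Phi a = (a \in s) by rewrite sE.
by split=> [/andP[]|[-> ->]].
Qed.

(** Induction on the number of positive roots of smaller height: a non-simple positive root stays
    positive and becomes lower under some simple reflection. *)
Lemma positive_root_simple b : Phi b -> 0 < ht b ->
  exists r a, [/\ {in r, forall c, c \in Delta}, a \in Delta & b = rword r *m a].
Proof.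
have [P Pu PE] := positive_roots_seq.
move: {2}(count _ _).+1 (leqnn (count (fun c => ht c < ht b) P).+1) => m.
elim: m b => // m IH b; rewrite ltnS => cb Pb hb.
have [bD|bD] := boolP (b \in Delta).
  by exists [::], b; split=> //; rewrite rword_nil mul1mx.
(* As [dot b b] is positive and [b] is a nonnegative combination of simple roots, one of these has
   positive dot product with [b]. *)
have [a aD] : exists2 a, a \in Delta & dot (- b) a < 0.
  apply: (simple_exists_lt0 (ht_gt0P Pb hb)).
  by rewrite dotNl oppr_lt0 dot_gt0// root_neq0.
rewrite dotNl oppr_lt0 dotC => ab; have a0 := root_neq0 (simple_root aD).
have ba : b != a by apply: contraNneq bD => ->.
have hsb := simple_reflmx_gt0 aD Pb hb ba.
have lt_ht : ht (reflmx a *m b) < ht b.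
  rewrite reflmxE dotBr dotZr (hl0 aD) mulr1 ltrBlDr ltrDl.
  by rewrite divr_gt0 ?mulr_gt0 ?dot_gt0.
have [|||r [c [rD cD bE]]] := IH (reflmx a *m b) => //.
- apply: leq_trans cb; apply: (@count_ltn _ _ _ _ (reflmx a *m b)) => //=.
  + by move=> c _ /lt_trans; apply.
  + by apply/PE; split=> //; apply: root_reflmx => //; exact: simple_root.
  + by rewrite ltxx.
- by apply: root_reflmx => //; exact: simple_root.
exists (a :: r), c; split=> //.
  by move=> d; rewrite inE => /predU1P[->|/rD].
by rewrite rword_cons -mulmxA -bE reflmxK.
Qed.

(** A positive root is a simple root moved by a simple word, so its reflection is the conjugate of a
    simple reflection by that word. *)
Lemma group_simpleP x : W x -> exists2 r, x = rword r & {in r, forall a, a \in Delta}.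
Proof.
move=> /groupP[r -> {x}]; elim: r => [|b r IH] rP.
  by exists [::]; rewrite ?rword_nil.
have [|s sE sD] := IH; first by move=> c cr; apply: rP; rewrite inE cr orbT.
have Pb : Phi b by apply: rP; rewrite mem_head.
wlog hb : b rP Pb / 0 < ht b => [H|].
  have [|hb] := ltP 0 (ht b); first exact: (H b).
  rewrite ht_le0// in hb; have Pb' := rootN Pb.
  have : exists2 r0, rword (- b :: r) = rword r0 & {in r0, forall a, a \in Delta}.
    apply: (H (- b)) => //; last by rewrite dotNr oppr_gt0.
    by move=> c; rewrite inE => /predU1P[->//|cr]; apply: rP; rewrite inE cr orbT.
  by rewrite !rword_cons reflmxN.
have [q [a [qD aD bE]]] := positive_root_simple Pb hb.
exists (q ++ a :: rev q ++ s); last first.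
  move=> c; rewrite mem_cat inE mem_cat mem_rev.
  by move=> /or4P[/qD|/eqP->|/qD|/sD].
rewrite rword_cons bE reflmx_conj; last exact: orth_rword.
by rewrite rword_cat rword_cons rword_cat rword_rev sE !mulmxA.
Qed.

(** * Simple words, exchange and inversions *)

Definition simple_word (r : seq 'cV[R]_n) : Prop := {in r, forall a, a \in Delta}.

Lemma simple_word_cat r1 r2 :
  simple_word (r1 ++ r2) <-> simple_word r1 /\ simple_word r2.
Proof.
split=> [H|[H1 H2] a]; last by rewrite mem_cat => /orP[/H1|/H2].
by split=> a ar; apply: H; rewrite mem_cat ar ?orbT.
Qed.

Lemma simple_word_cons a r :
  simple_word (a :: r) <-> a \in Delta /\ simple_word r.
Proof.
split=> [H|[aD rD] b]; last by rewrite inE => /predU1P[->|/rD].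
by split=> [|b br]; apply: H; rewrite inE ?eqxx ?br ?orbT.
Qed.

Lemma simple_word_rev r : simple_word (rev r) <-> simple_word r.
Proof. by split=> H a ar; apply: H; rewrite ?mem_rev// -[r]revK mem_rev. Qed.

Lemma simple_word_group r : simple_word r -> W (rword r).
Proof. by move=> rD; apply/groupP; exists r => // a /rD/simple_root. Qed.

(** The strong exchange condition. As letters are peeled off the front, the root stays positive
    until it equals the next letter, since a simple reflection makes only its own root negative. *)
Lemma exchange r b : simple_word r -> Phi b -> 0 < ht b ->
  ht ((rword r)^T *m b) < 0 ->
  exists r1 a r2, r = r1 ++ a :: r2 /\ b = rword r1 *m a.
Proof.
elim: r b => [|a r IH] b.
  by rewrite rword_nil trmx1 mul1mx => _ _ /lt_trans/[apply]; rewrite ltxx.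
move=> /simple_word_cons[aD rD] Pb hb; rewrite rword_cons trmx_mul reflmx_tr -mulmxA.
have [<- _|ba] := eqVneq b a.
  by exists [::], b, r; rewrite rword_nil mul1mx.
move=> /(IH _ rD)[||r1 [c [r2 [-> cE]]]].
- by apply: root_reflmx => //; exact: simple_root.
- exact: simple_reflmx_gt0.
exists (a :: r1), c, r2; split=> //.
by rewrite rword_cons -mulmxA -cE reflmxK.
Qed.

Lemma reflmx_rword_delete r1 a r2 :
  reflmx (rword r1 *m a) *m rword (r1 ++ a :: r2) = rword (r1 ++ r2).
Proof.
rewrite reflmx_conj; last exact: orth_rword.
rewrite !rword_cat rword_cons -!mulmxA orthK; last exact: orth_rword.
by rewrite reflmxK.
Qed.

Definition reduced (r : seq 'cV[R]_n) : Prop :=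
  forall r', simple_word r' -> rword r' = rword r -> (size r <= size r')%N.

Lemma reduced_exists x : W x -> exists r, [/\ simple_word r, rword r = x & reduced r].
Proof.
move=> /group_simpleP[r0 r0E r0D].
pose p k := `[< exists r, [/\ simple_word r, rword r = x & size r = k] >].
have [|k /asboolP[r [rD rE rk]] kmin] := @ex_minnP p.
  by exists (size r0); apply/asboolP; exists r0.
exists r; split=> // r' r'D r'E; rewrite rk; apply: kmin; apply/asboolP.
by exists r'; rewrite r'E.
Qed.

Lemma reduced_expressionP x s : reduced_expression Delta x s <->
  exists r, [/\ s = map reflmx r, simple_word r, rword r = x & reduced r].
Proof.
split=> [[[/word_in_map[r -> rD] rE] smin]|[r [-> rD rE rmin]]].
  exists r; split=> // r' r'D r'E; have := smin (map reflmx r').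
  rewrite !size_map; apply; split; last by rewrite -rE.
  exact: (@map_word_in _ _ [set a | a \in Delta]).
split; first by split=> //; exact: (@map_word_in _ _ [set a | a \in Delta]).
move=> s' [/word_in_map[r' -> r'D] r'E]; rewrite !size_map.
by apply: rmin => //; rewrite rE -r'E.
Qed.

Lemma coxeter_lengthE x r : simple_word r -> rword r = x -> reduced r ->
  coxeter_length Delta x = size r.
Proof.
move=> rD rE rmin; rewrite /coxeter_length.
have : [set size s | s in reduced_expression Delta x]
    (xget 0%N [set size s | s in reduced_expression Delta x]).
  apply: xgetPex; exists (size (map (@reflmx R n) r)); exists (map reflmx r) => //.
  by apply/reduced_expressionP; exists r.
move=> [s /reduced_expressionP[r' [-> r'D r'E r'min]] <-]; rewrite size_map.
by apply/eqP; rewrite eqn_leq r'min ?rmin ?r'E ?rE.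
Qed.

Lemma coxeter_length_le r : simple_word r ->
  (coxeter_length Delta (rword r) <= size r)%N.
Proof.
move=> rD; have [r' [r'D r'E r'min]] := reduced_exists (simple_word_group rD).
by rewrite (coxeter_lengthE r'D r'E)// r'min.
Qed.

Lemma coxeter_length_lt x b : W x -> Phi b -> 0 < ht b -> ht (x^T *m b) < 0 ->
  (coxeter_length Delta (reflmx b *m x) < coxeter_length Delta x)%N.
Proof.
move=> Wx Pb hb; have [r [rD <- rmin]] := reduced_exists Wx.
move=> /(exchange rD Pb hb)[r1 [a [r2 [rE ->]]]].
rewrite (coxeter_lengthE rD erefl rmin) rE reflmx_rword_delete.
rewrite size_cat /= addnS ltnS -size_cat; apply: coxeter_length_le.
move: rD; rewrite rE => /simple_word_cat[r1D /simple_word_cons[_ r2D]].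
exact/simple_word_cat.
Qed.

(** The upward edges of the Bruhat graph, with the comparison of lengths replaced by the sign of the
    root [x^-1 b]. *)
Definition edge x y : Prop :=
  exists b, [/\ Phi b, 0 < ht b, 0 < ht (x^T *m b) & y = reflmx b *m x].

Lemma ht_reflmx_tr x b : ht ((reflmx b *m x)^T *m b) = - ht (x^T *m b).
Proof. by rewrite trmx_mul reflmx_tr -mulmxA reflmx_self mulmxN dotNr. Qed.

Lemma group_reflmxM a x : Phi a -> W x -> W (reflmx a *m x).
Proof. by move=> Pa; apply: groupM; exact: group_reflmx. Qed.

Lemma root_trM x a : W x -> Phi a -> Phi (x^T *m a).
Proof. by move=> Wx; apply: root_mul; exact: group_tr. Qed.

Lemma edge_group x y : W x -> edge x y -> W y.
Proof. by move=> Wx [b [Pb _ _ ->]]; exact: group_reflmxM. Qed.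

Lemma edge_reflmx x b : W x -> Phi b -> 0 < ht b -> ht (x^T *m b) < 0 ->
  edge (reflmx b *m x) x.
Proof.
move=> Wx Pb hb xb; exists b; split=> //; last by rewrite reflmxK.
by rewrite ht_reflmx_tr oppr_gt0.
Qed.

Lemma bruhat_stepP x y : bruhat_step W Delta x y <-> W x /\ edge x y.
Proof.
split=> [[Wx [t /reflection_root[b Pb ->] [yE lxy]]]|[Wx [b [Pb hb xb yE]]]].
  split=> //; wlog hb : b Pb yE / 0 < ht b => [H|].
    have [|] := ltP 0 (ht b); first exact: H.
    rewrite ht_le0// => hb; apply: (H (- b)); first exact: rootN.
      by rewrite reflmxN.
    by rewrite dotNr oppr_gt0.
  exists b; split=> //; rewrite ltNge ht_le0; last exact: root_trM.
  apply/negP => /(coxeter_length_lt Wx Pb hb).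
  by rewrite -yE ltnNge ltnW.
split=> //; exists (reflmx b).
  by split; [exact: group_reflmx | exists b => //; exact: root_neq0].
split=> //; rewrite yE -{1}(reflmxK b x); apply: coxeter_length_lt => //.
  exact: group_reflmxM.
by rewrite ht_reflmx_tr oppr_lt0.
Qed.

(** If one of the signs were wrong, exchange in [r1] or in [r2] would cancel [a] against another
    letter and give a word shorter by two. *)
Lemma reduced_inversion r1 a r2 : simple_word (r1 ++ a :: r2) ->
  reduced (r1 ++ a :: r2) ->
  0 < ht (rword r1 *m a) /\
  ht ((rword (r1 ++ a :: r2))^T *m (rword r1 *m a)) < 0.
Proof.
move=> /simple_word_cat[r1D /simple_word_cons[aD r2D]] rmin.
have Pa := simple_root aD; have ha := simple_ht_gt0 aD; split.
  rewrite ltNge ht_le0; last by apply: root_mul => //; exact: simple_word_group.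
  apply/negP => h; have [||||q1 [c [q2 [qE aE]]]] := @exchange (rev r1) a => //.
  - exact/simple_word_rev.
  - by rewrite rword_rev trmxK.
  have r1E : r1 = rev (q1 ++ c :: q2) by rewrite -qE revK.
  have qD : simple_word (q1 ++ c :: q2) by rewrite -qE; exact/simple_word_rev.
  move: qD => /simple_word_cat[q1D /simple_word_cons[_ q2D]].
  suff : (size (r1 ++ a :: r2) <= size (rev (q1 ++ q2) ++ r2))%N.
    by rewrite r1E !size_cat /= !size_rev !size_cat /=; lia.
  apply: rmin.
    by apply/simple_word_cat; split=> //; apply/simple_word_rev/simple_word_cat.
  rewrite [in RHS]rword_cat rword_cons mulmxA rword_cat; congr (_ *m _).
  rewrite r1E !rword_rev -(reflmx_rword_delete q1 c q2) -aE.
  by rewrite [in LHS]trmx_mul reflmx_tr.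
rewrite ltNge -oppr_le0 -dotNr rword_cat rword_cons !trmx_mul -!mulmxA.
rewrite orthK; last exact: orth_rword.
rewrite reflmx_tr reflmx_self mulmxN opprK ht_le0; last first.
  by apply: root_trM => //; exact: simple_word_group.
apply/negP => /(exchange r2D Pa ha)[q1 [c [q2 [r2E aE]]]].
suff : (size (r1 ++ a :: r2) <= size (r1 ++ q1 ++ q2))%N.
  by rewrite r2E !size_cat /= !size_cat /=; lia.
apply: rmin.
  move: r2D; rewrite r2E => /simple_word_cat[q1D /simple_word_cons[_ q2D]].
  by do 2!(apply/simple_word_cat; split=> //).
rewrite !(rword_cat r1); congr (_ *m _).
by rewrite -(reflmx_rword_delete q1 c q2) -aE -r2E rword_cons.
Qed.

(** Letters of a reduced word give roots that [x^-1] makes negative; exchange finds the letter of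
    any such root. *)
Lemma inversionsP x b : W x -> Phi b -> 0 < ht b ->
  inversions Delta x (reflmx b) <-> ht (x^T *m b) < 0.
Proof.
move=> Wx Pb hb; split.
  move=> [s [i [/reduced_expressionP[r [-> rD <- rmin]]]]]; rewrite size_map.
  move=> ir tE; have [a aE] : exists a, a = nth 0 r i by eexists.
  have rE : r = take i r ++ a :: drop i.+1 r by rewrite aE -drop_nth// cat_take_drop.
  have [hc xc] := reduced_inversion (eq_ind _ simple_word rD _ rE)
                                    (eq_ind _ reduced rmin _ rE).
  move: xc; rewrite -rE => xc.
  suff -> : b = rword (take i r) *m a by [].
  have aD : a \in Delta by rewrite aE; apply: rD; exact: mem_nth.
  have : reflmx (rword (take i r) *m a) = reflmx b.
    rewrite tE (nth_map 0)// -aE -map_take -map_rev reflmx_conj; last exact: orth_rword.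
    by rewrite -rword_rev.
  move=> /root_reflmx_inj[]//.
    apply: root_mul; last exact: simple_root.
    by apply: simple_word_group => c /mem_take/rD.
  by move=> bE; move: hb; rewrite bE dotNr oppr_gt0 ltNge ltW.
have [r [rD <- rmin]] := reduced_exists Wx.
move=> /(exchange rD Pb hb)[r1 [a [r2 [rE bE]]]].
exists (map reflmx r), (size r1); split.
- by apply/reduced_expressionP; exists r.
- by rewrite size_map rE size_cat /= -addSnnS leq_addr.
rewrite rE map_cat take_size_cat ?size_map// nth_cat size_map ltnn subnn /=.
by rewrite bE reflmx_conj -?map_rev -?rword_rev//; exact: orth_rword.
Qed.

(** For a word a_1, a_2, a_3, ... with reflections s_i this is the sequence a_1, s_1 a_2, s_1 s_2
    a_3, ...; its order is the one used for broken circuits. *)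
Fixpoint inversion_roots (r : seq 'cV[R]_n) : seq 'cV[R]_n :=
  if r is a :: r' then a :: map (mulmx (reflmx a)) (inversion_roots r') else [::].

Lemma inversion_roots_split r L0 b L1 : inversion_roots r = L0 ++ b :: L1 ->
  exists r1 a r2, [/\ r = r1 ++ a :: r2, L0 = inversion_roots r1 & b = rword r1 *m a].
Proof.
elim: r L0 b L1 => [|a r IH] [|c L0] b L1 //=.
  by move=> -[-> _]; exists [::], b, r; rewrite rword_nil mul1mx.
move=> [<- /(congr1 (map (mulmx (reflmx a))))].
rewrite map_cat /= -map_comp map_id_in; last by move=> v _ /=; rewrite reflmxK.
move=> /IH[r1 [d [r2 [-> L0E bE]]]]; exists (a :: r1), d, r2; split=> //=.
  rewrite -L0E -map_comp map_id_in//; first by move=> v _ /=; rewrite reflmxK.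
by rewrite rword_cons -mulmxA -bE reflmxK.
Qed.

Lemma mem_inversion_roots r1 a r2 : rword r1 *m a \in inversion_roots (r1 ++ a :: r2).
Proof.
elim: r1 => [|c r1 IH] /=; first by rewrite rword_nil mul1mx mem_head.
by rewrite inE rword_cons -mulmxA map_f ?orbT.
Qed.

Definition subspace (B : pred 'cV[R]_n) : Prop :=
  (forall a b, B a -> B b -> B (a + b)) /\ (forall k a, B a -> B (k *: a)).

Lemma subspaceN B a : subspace B -> B a -> B (- a).
Proof. by move=> [_ BZ] /(BZ (-1)); rewrite scaleN1r. Qed.

Lemma subspace_reflmx B a b : subspace B -> B a -> B b -> B (reflmx a *m b).
Proof.
move=> Bs Ba Bb; rewrite reflmxE; apply: Bs.1 => //.
by apply: (subspaceN Bs); apply: Bs.2.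
Qed.

Lemma subspace_inX x y : subspace (inX x y).
Proof. by split=> [a b|k a]; [exact: inXD | exact: inXZ]. Qed.

(** For a positive root [b] in [B] this says that [b] is simple for the reflection subgroup
    generated by the roots in [B]. *)
Definition simple_in (B : pred 'cV[R]_n) b : Prop :=
  forall c, Phi c -> 0 < ht c -> B c -> c != b -> 0 < ht (reflmx b *m c).

(** All that is retained of a reduced word: its inversions, in an order for which the first one in
    any subspace is simple for the roots of this subspace. *)
Definition inversion_seq x (L : seq 'cV[R]_n) : Prop :=
  [/\ forall b, b \in L <-> [/\ Phi b, 0 < ht b & ht (x^T *m b) < 0]
    & forall B L0 b L1, subspace B -> L = L0 ++ b :: L1 ->
        {in L0, forall c, ~~ B c} -> B b -> simple_in B b].

(** Let [z] be the prefix before the first inversion [b] in [B]. No inversion of [z] lies in [B], so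
    [z^-1] keeps the positive roots of [B] positive; it sends [b] to the simple root [a], whose
    simplicity is carried back. *)
Lemma inversion_seq_exists x : W x -> exists L, inversion_seq x L.
Proof.
move=> Wx; have [r [rD rE rmin]] := reduced_exists Wx.
exists (inversion_roots r); split=> [b|B L0 b L1 Bs].
  split=> [bL|].
    have [L0 [L1 E]] : exists L0 L1, inversion_roots r = L0 ++ b :: L1.
      by case/path.splitPr: bL => L0 L1; exists L0, L1.
    have [r1 [a [r2 [rE' _ ->]]]] := inversion_roots_split E.
    rewrite rE' in rD rmin; have [hb xb] := reduced_inversion rD rmin.
    split=> //; last by rewrite -rE rE'.
    move/simple_word_cat: rD => [r1D /simple_word_cons[aD _]].
    by apply: root_mul; [exact: simple_word_group | exact: simple_root].
  move=> [Pb hb]; rewrite -rE => /(exchange rD Pb hb)[r1 [a [r2 [-> ->]]]].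
  exact: mem_inversion_roots.
move=> /inversion_roots_split[r1 [a [r2 [rE' -> bE]]]] L0B Bb.
move: rD; rewrite rE' => /simple_word_cat[r1D /simple_word_cons[aD _]].
have Wz := simple_word_group r1D; set z := rword r1 in Wz bE.
have zo : orth z := group_orth Wz.
have zpos c : Phi c -> 0 < ht c -> B c -> 0 < ht (z^T *m c).
  move=> Pc hc Bc; rewrite ltNge ht_le0; last exact: root_trM.
  apply/negP => /(exchange r1D Pc hc)[q1 [d [q2 [r1E cE]]]].
  have := L0B c; rewrite Bc => /(_ _)/negP[]//.
  by rewrite r1E cE; exact: mem_inversion_roots.
move=> c Pc hc Bc cb.
have Pb : Phi b by rewrite bE; apply: root_mul => //; exact: simple_root.
have sE : z^T *m (reflmx b *m c) = reflmx a *m (z^T *m c).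
  by rewrite bE reflmx_conj// -!mulmxA orthK.
have h : 0 < ht (z^T *m (reflmx b *m c)).
  rewrite sE; apply: simple_reflmx_gt0 => //; first exact: root_trM.
    exact: zpos.
  by apply: contra cb => /eqP; rewrite bE => <-; rewrite orthKV.
rewrite ltNge ht_le0; last exact: root_reflmx.
apply/negP => sc; have : 0 < ht (z^T *m (- (reflmx b *m c))).
  apply: zpos; first by apply: rootN; exact: root_reflmx.
    by rewrite dotNr oppr_gt0.
  by apply: (subspaceN Bs); exact: subspace_reflmx.
by rewrite mulmxN dotNr oppr_gt0 ltNge ltW.
Qed.

(** * Geodesics in the Bruhat graph *)

(** Upward paths; labels in [B] keep a path inside one coset of the reflection subgroup of [B]. *)
Fixpoint dpath (B : pred 'cV[R]_n) (k : nat) x y : Prop :=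
  if k is k'.+1 then
    exists b, [/\ Phi b, 0 < ht b, 0 < ht (x^T *m b), B b
                & dpath B k' (reflmx b *m x) y]
  else x = y.

Lemma dpath_group B k x y : W x -> dpath B k x y -> W y.
Proof.
elim: k x => [|k IH] x Wx; first by move=> <-.
by move=> [b [Pb _ _ _ /IH]]; apply; exact: group_reflmxM.
Qed.

Lemma dpath_sub (B B' : pred 'cV[R]_n) k x y : (forall b, B b -> B' b) ->
  dpath B k x y -> dpath B' k x y.
Proof.
move=> BB'; elim: k x => [//|k IH] x [b [Pb hb xb Bb /IH p]].
by exists b; split=> //; exact: BB'.
Qed.

Lemma dpath_cat B k1 k2 x y z : dpath B k1 x y -> dpath B k2 y z ->
  dpath B (k1 + k2) x z.
Proof.
elim: k1 x => [|k IH] x; first by move=> ->.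
by move=> [b [Pb hb xb Bb /IH p]] /p q; exists b.
Qed.

Lemma bruhat_leP x y : W x ->
  bruhat_le W Delta x y <-> exists k, dpath predT k x y.
Proof.
move=> Wx; split=> [|[k]].
  move=> le; elim: le Wx => {x y} [x y st|x|x y z _ IH1 _ IH2] Wx.
  - by have /bruhat_stepP[_ [b [Pb hb xb ->]]] := st; exists 1%N, b.
  - by exists 0%N.
  - have [k1 p1] := IH1 Wx; have [k2 p2] := IH2 (dpath_group Wx p1).
    by exists (k1 + k2)%N; exact: dpath_cat p1 p2.
elim: k x Wx => [|k IH] x Wx; first by move=> ->; exact: rt_refl.
move=> [b [Pb hb xb _ /IH le]]; apply: (rt_trans _ _ _ (reflmx b *m x)).
  by apply: rt_step; apply/bruhat_stepP; split=> //; exists b.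
by apply: le; exact: group_reflmxM.
Qed.

Lemma edge_bruhat_le x y : W x -> edge x y -> bruhat_le W Delta x y.
Proof. by move=> Wx exy; apply: rt_step; apply/bruhat_stepP. Qed.

Lemma rdist_reflmx_root x b : W x -> Phi b -> rdist (reflmx b *m x) x = 1%N.
Proof.
by move=> Wx Pb; apply: rdist_reflmx; [exact: group_orth | exact: root_neq0].
Qed.

Lemma dpath_rdist B k x y : W x -> dpath B k x y -> (rdist x y <= k)%N.
Proof.
elim: k x => [|k IH] x Wx; first by move=> ->; rewrite /rdist subrr mxrank0.
move=> [b [Pb hb xb _ /IH]] => /(_ (group_reflmxM Pb Wx)) le.
apply: leq_trans (rdist_triangle _ (reflmx b *m x) _) _.
by rewrite rdist_sym rdist_reflmx_root.
Qed.

(* The labels of a geodesic are independent, so they all lie in the moved space. *)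
Lemma dpath_inX k x y : W x -> rdist x y = k -> dpath predT k x y ->
  dpath (inX x y) k x y.
Proof.
elim: k x => [//|k IH] x Wx dk [b [Pb hb xb _ p]].
have Wz := group_reflmxM Pb Wx; have Wy := dpath_group Wz p.
have [xo yo b0] := And3 (group_orth Wx) (group_orth Wy) (root_neq0 Pb).
have bX : inX x y b.
  apply/negPn/negP => bX; have := dpath_rdist Wz p.
  by rewrite rdist_reflmx_notin// dk; lia.
have := rdist_reflmx_in xo yo b0 bX; rewrite dk => -[/esym/IH]/(_ Wz p) q.
exists b; split=> //; apply: dpath_sub q => c; exact: sub_reflmx_in.
Qed.

(** The lifting property. Conjugating the labels by [reflmx b] moves the path to one starting at
    [reflmx b *m x], with labels still positive because [b] is simple for [B]; it rejoins the old
    path where a label equals [b] or [b] becomes a descent. *)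
Lemma dpath_lift B b k x y : subspace B -> Phi b -> 0 < ht b -> B b ->
  simple_in B b -> ht (y^T *m b) < 0 -> W x -> dpath B k x y ->
  0 < ht (x^T *m b) ->
  exists2 j, (j <= k.+1)%N & dpath B j (reflmx b *m x) y.
Proof.
move=> Bs Pb hb Bb bsimple yb; elim: k x => [|k IH] x Wx.
  by move=> /= xy xb; move: yb; rewrite -xy ltNge ltW.
move=> [a [Pa ha xa Ba p]] xb.
have [ab|ab] := eqVneq a b; first by rewrite -ab; exists k => //; rewrite -addn2 leq_addr.
have Wz := group_reflmxM Pa Wx; set z := reflmx a *m x in Wz p.
have sE : reflmx (reflmx b *m a) *m (reflmx b *m x) = reflmx b *m z.
  rewrite reflmx_conj; last exact: orth_reflmx.
  by rewrite reflmx_tr -!mulmxA reflmxK.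
suff [j jk q] : exists2 j, (j <= k.+1)%N & dpath B j (reflmx b *m z) y.
  exists j.+1 => //; exists (reflmx b *m a); split=> //.
  - exact: root_reflmx.
  - exact: bsimple.
  - by rewrite trmx_mul reflmx_tr -mulmxA reflmxK.
  - exact: subspace_reflmx.
  - by rewrite sE.
(* If [b] is a descent of [z], a step labelled [b] leads from [reflmx b *m z] back up to [z]. *)
have [zb|] := ltP 0 (ht (z^T *m b)); first exact: IH.
rewrite ht_le0; last exact: root_trM.
move=> zb; exists k.+1 => //; exists b; split=> //; last by rewrite reflmxK.
by rewrite ht_reflmx_tr oppr_gt0.
Qed.

(** * Products without broken circuits and geodesics *)

Section NBC.
Context (w : 'M[R]_n) (hw : W w).

Local Notation nbc := (nbc_products w).

(** Inverts [nbc_step]: the root [b] has been used for [u] exactly when it lies in the moved space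
    of [u w^-1]. *)
Definition nbc_decode b u := if inX u w b then reflmx b *m u else u.

Lemma mem_nbc_block b y u : Phi b -> W y ->
  u \in (if inX y w b then [::] else [:: y; reflmx b *m y]) ->
  y = nbc_decode b u.
Proof.
move=> Pb Wy; rewrite /nbc_decode; case: ifPn => // yb.
have [yo wo] := (group_orth Wy, group_orth hw).
rewrite !inE => /orP[]/eqP ->; first by rewrite (negPf yb).
by rewrite sub_reflmx_notin ?eqxx ?orbT// reflmxK.
Qed.

Lemma nbc_group L : {in L, forall b, Phi b} -> {in nbc L, forall y, W y}.
Proof.
elim: L => [|b L IH] LP y /=; first by rewrite inE => /eqP ->.
have {}IH : {in nbc L, forall y, W y}.
  by apply: IH => c cL; apply: LP; rewrite inE cL orbT.
move=> /flatten_mapP[z /IH Wz]; case: ifP => // _; rewrite !inE => /orP[]/eqP->//.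
by apply: group_reflmxM => //; apply: LP; rewrite mem_head.
Qed.

Lemma mem_nbc_cons b L u : {in b :: L, forall b, Phi b} -> W u ->
  (u \in nbc (b :: L)) = (nbc_decode b u \in nbc L).
Proof.
move=> LP Wu; have Pb : Phi b by apply: LP; rewrite mem_head.
have LP' : {in L, forall b, Phi b} by move=> c cL; apply: LP; rewrite inE cL orbT.
apply/idP/idP => [/flatten_mapP[y yL /mem_nbc_block <-//]|].
  exact: nbc_group LP' _ yL.
rewrite /nbc_decode; case: ifPn => ub uL; apply/flatten_mapP.
  exists (reflmx b *m u) => //; rewrite (negPf (notin_reflmx _ _ _ ub)).
  - by rewrite reflmxK !inE eqxx orbT.
  - exact: group_orth.
  - exact: group_orth.
  - exact: root_neq0.
by exists u => //; rewrite (negPf ub) mem_head.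
Qed.

(** Injectivity of the product map: [y] is decoded from either of the two products it gives rise to,
    so the blocks of distinct [y] are disjoint. *)
Lemma nbc_uniq L : {in L, forall b, Phi b} -> uniq (nbc L).
Proof.
elim: L => [//|b L IH] LP; have Pb : Phi b by apply: LP; rewrite mem_head.
have LP' : {in L, forall b, Phi b} by move=> c cL; apply: LP; rewrite inE cL orbT.
have := IH LP'; have := nbc_group LP'; rewrite /=.
elim: (nbc L) => [//|y S IHS] WS /= /andP[yS uS].
have Wy : W y by apply: WS; rewrite mem_head.
have WS' : {in S, forall y, W y} by move=> z zS; apply: WS; rewrite inE zS orbT.
rewrite cat_uniq IHS// andbT; apply/andP; split.
  case: ifPn => // yb; rewrite /= inE andbT; apply/negP => /eqP yE.
  move/negP: (yb); apply; rewrite {1}yE; apply: sub_reflmx_notin => //.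
  - exact: group_orth.
  - exact: group_orth.
  - by rewrite eqxx orbT.
apply/hasPn => u /flatten_mapP[z zS /(mem_nbc_block Pb (WS' z zS)) zE].
apply/negP => /(mem_nbc_block Pb Wy) yE.
by move: yS; rewrite yE -zE zS.
Qed.

(** The least reflection used for [u] is the first one whose root lies in the moved space, and
    removing it leaves a set without broken circuits. *)
Lemma nbc_first L u : {in L, forall b, Phi b} -> u \in nbc L -> u != w ->
  exists L0 b L1, [/\ L = L0 ++ b :: L1, {in L0, forall c, ~~ inX u w c},
    inX u w b & reflmx b *m u \in nbc L].
Proof.
elim: L u => [|b L IH] u LP; first by rewrite inE => ->.
move=> uL uw; have Wu := nbc_group LP uL; move: (uL).
have Pb : Phi b by apply: LP; rewrite mem_head.
have [uo wo b0] := And3 (group_orth Wu) (group_orth hw) (root_neq0 Pb).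
have LP' : {in L, forall b, Phi b} by move=> c cL; apply: LP; rewrite inE cL orbT.
rewrite mem_nbc_cons// /nbc_decode; case: ifPn => ub uL'.
  exists [::], b, L; split=> //; rewrite mem_nbc_cons//; last exact: group_reflmxM.
  by rewrite /nbc_decode (negPf (notin_reflmx _ _ _ ub)).
have [L0 [c [L1 [LE L0u uc cuL]]]] := IH u LP' uL' uw.
have Pc : Phi c by apply: LP'; rewrite LE mem_cat mem_head orbT.
exists (b :: L0), c, L1; split=> //; first by rewrite LE.
  by move=> d; rewrite inE => /predU1P[->|/L0u].
rewrite mem_nbc_cons//; last exact: group_reflmxM.
rewrite /nbc_decode ifN//; apply: contra ub; apply: sub_reflmx_in => //.
exact: root_neq0.
Qed.

(** Decoding along [L0] changes neither [u] nor [reflmx b *m u], whose moved space is smaller; at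
    [b] both decode to [reflmx b *m u]. *)
Lemma nbc_first_mem L0 b L1 u : {in L0 ++ b :: L1, forall b, Phi b} -> W u ->
  {in L0, forall c, ~~ inX u w c} -> inX u w b ->
  reflmx b *m u \in nbc (L0 ++ b :: L1) -> u \in nbc (L0 ++ b :: L1).
Proof.
have wo := group_orth hw.
elim: L0 => [|c L0 IH] LP Wu L0u ub.
  have Pb : Phi b by apply: LP; rewrite mem_head.
  have [uo b0] := (group_orth Wu, root_neq0 Pb).
  rewrite !mem_nbc_cons//; last exact: group_reflmxM.
  by rewrite /nbc_decode ub (negPf (notin_reflmx _ _ _ ub)).
have Pb : Phi b by apply: LP; rewrite mem_cat mem_head orbT.
have [uo b0] := (group_orth Wu, root_neq0 Pb).
have uc : ~~ inX u w c by apply: L0u; rewrite mem_head.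
rewrite !mem_nbc_cons//; last exact: group_reflmxM.
rewrite /nbc_decode (negPf uc) ifN; last first.
  by apply: contra uc; exact: sub_reflmx_in.
apply: IH => //; first by move=> d dL; apply: LP; rewrite inE dL orbT.
by move=> d dL; apply: L0u; rewrite inE dL orbT.
Qed.

Lemma mem_nbc_w L : {in L, forall b, Phi b} -> w \in nbc L.
Proof.
elim: L => [|b L IH] LP; first by rewrite inE.
rewrite mem_nbc_cons// /nbc_decode inX_id ifN; last first.
  by apply: root_neq0; apply: LP; rewrite mem_head.
by apply: IH => c cL; apply: LP; rewrite inE cL orbT.
Qed.

Section Inversions.
Context (L : seq 'cV[R]_n) (hL : inversion_seq w L).

Lemma inversion_seq_root : {in L, forall b, Phi b}.
Proof. by move=> b bL; have [] := (hL.1 b).1 bL. Qed.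

(** Induction on the distance: with [b] the least reflection used, [z = reflmx b *m u] has a
    geodesic to [w]. If [b] goes up from [u] it is prepended; otherwise the geodesic is lifted along
    [b], which is simple for the moved space, and its length grows by at most one. *)
Lemma nbc_dpath u : u \in nbc L -> dpath predT (rdist u w) u w.
Proof.
have LP := inversion_seq_root.
move: {2}(rdist u w) (leqnn (rdist u w)) => m; elim: m u => [|m IH] u.
  by rewrite leqn0 rdist_eq0 => /eqP -> _; rewrite /rdist subrr mxrank0.
have [->|uw] := eqVneq u w; first by rewrite /rdist subrr mxrank0.
move=> um uL; have Wu := nbc_group LP uL.
have [L0 [b [L1 [LE L0u ub sL]]]] := nbc_first LP uL uw.
have [Pb hb wb] : [/\ Phi b, 0 < ht b & ht (w^T *m b) < 0].
  by apply/hL.1; rewrite LE mem_cat mem_head orbT.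
have [uo wo b0] := And3 (group_orth Wu) (group_orth hw) (root_neq0 Pb).
have Wz := group_reflmxM Pb Wu; set z := reflmx b *m u in Wz sL.
have dE : rdist u w = (rdist z w).+1 by exact: rdist_reflmx_in.
have {IH sL} p : dpath predT (rdist z w) z w by apply: IH sL; rewrite -ltnS -dE.
have [ub0|] := ltP 0 (ht (u^T *m b)); first by rewrite dE; exists b.
rewrite ht_le0; last exact: root_trM.
move=> ub0; have zb : 0 < ht (z^T *m b) by rewrite ht_reflmx_tr oppr_gt0.
have q : dpath (inX u w) (rdist z w) z w.
  by apply: dpath_sub (dpath_inX Wz erefl p) => c; exact: sub_reflmx_in.
have bs : simple_in (inX u w) b by apply: (hL.2 _ L0 b L1) => //; exact: subspace_inX.
have [j] := dpath_lift (subspace_inX u w) Pb hb ub bs wb Wz q zb.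
rewrite /z reflmxK -/z -dE => ju r.
have -> : rdist u w = j by apply/eqP; rewrite eqn_leq ju (dpath_rdist Wu r).
exact: dpath_sub r.
Qed.

Lemma dpath_inversion B k x y : W x -> dpath B k.+1 x y ->
  exists b, [/\ Phi b, 0 < ht b, B b & ht (y^T *m b) < 0].
Proof.
elim: k x => [|k IH] x Wx [b [Pb hb xb Bb p]].
  by exists b; split=> //; rewrite -p ht_reflmx_tr oppr_lt0.
by apply: IH p; exact: group_reflmxM.
Qed.

(** Induction on the distance, with [b] the first inversion of [w] in the moved space. By lifting,
    or because it lies below [u], [reflmx b *m u] is still in the ideal, hence is a product, and so
    is [u]. *)
Lemma geodesic_nbc :
  (forall u, bruhat_ideal W Delta w u -> dpath predT (rdist u w) u w) ->
  forall u, bruhat_ideal W Delta w u -> u \in nbc L.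
Proof.
have LP := inversion_seq_root; move=> geo u.
move: {2}(rdist u w) (leqnn (rdist u w)) => m; elim: m u => [|m IH] u.
  by rewrite leqn0 rdist_eq0 => /eqP -> _; exact: mem_nbc_w.
have [->|uw] := eqVneq u w; first by move=> _ _; exact: mem_nbc_w.
move=> um uI; have := geo u uI; case: (uI) => Wu ulew p.
have q := dpath_inX Wu erefl p.
have uw0 : rdist u w = (rdist u w).-1.+1.
  by rewrite prednK// lt0n rdist_eq0.
(* The last label of a geodesic from [u] is an inversion of [w] lying in the moved space. *)
have hasb : has (inX u w) L.
  move: q; rewrite {1}uw0 => /(dpath_inversion Wu)[b [Pb hb Bb wb]].
  by apply/hasP; exists b => //; apply/hL.1.
have [L0 [b [L1 [LE L0u ub]]]] : exists L0 b L1,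
    [/\ L = L0 ++ b :: L1, {in L0, forall c, ~~ inX u w c} & inX u w b].
  exists (take (find (inX u w) L) L), (nth 0 L (find (inX u w) L)),
    (drop (find (inX u w) L).+1 L); split.
  - by rewrite -drop_nth -?has_find// cat_take_drop.
  - move=> c cL; apply/negP => uc.
    have : has (inX u w) (take (find (inX u w) L) L) by apply/hasP; exists c.
    by rewrite has_take_leq ?find_size// ltnn.
  - exact: nth_find.
have [Pb hb wb] : [/\ Phi b, 0 < ht b & ht (w^T *m b) < 0].
  by apply/hL.1; rewrite LE mem_cat mem_head orbT.
have [uo wo b0] := And3 (group_orth Wu) (group_orth hw) (root_neq0 Pb).
have Wz := group_reflmxM Pb Wu.
have sL : reflmx b *m u \in nbc L.
  apply: IH.
    by rewrite -ltnS -(rdist_reflmx_in uo wo b0 ub).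
  split=> //; have [ub0|] := ltP 0 (ht (u^T *m b)).
    have bs : simple_in (inX u w) b.
      by apply: (hL.2 _ L0 b L1) => //; exact: subspace_inX.
    have [j _ r] := dpath_lift (subspace_inX u w) Pb hb ub bs wb Wu q ub0.
    by apply/bruhat_leP => //; exists j; apply: dpath_sub r.
  rewrite ht_le0; last exact: root_trM.
  move=> ub0; apply: (rt_trans _ _ _ u) => //.
  by apply: edge_bruhat_le => //; exact: edge_reflmx.
by move: LP sL; rewrite LE => LP; exact: nbc_first_mem.
Qed.

End Inversions.
End NBC.
(** * Descents in the moved space *)

(** None of the hyperplanes contains the fixed space, so a point of it can be moved off them one at
    a time by small perturbations. *)
Lemma generic_fixed x y (Ls : seq 'cV[R]_n) : {in Ls, forall b, ~~ inX x y b} ->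
  exists2 e, x^T *m e = y^T *m e & {in Ls, forall b, dot b e != 0}.
Proof.
elim: Ls => [|b Ls IH] LX; first by exists 0; rewrite ?mulmx0.
have [|e xye eL] := IH; first by move=> c cL; apply: LX; rewrite inE cL orbT.
have [be|be] := eqVneq (dot b e) 0; last first.
  by exists e => // c; rewrite inE => /predU1P[->|/eL].
have [f xyf bf] : exists2 v, x^T *m v = y^T *m v & dot b v != 0.
  by apply: inXPn; apply: LX; rewrite mem_head.
have [eps eps0 H] := perturb_sign Ls e f.
exists (e + eps *: f); first by rewrite !mulmxDr -!scalemxAr xye xyf.
move=> c; rewrite inE => /predU1P[->|cL].
  by rewrite dotDr dotZr be add0r mulf_neq0// gt_eqF.
have := H eps eps0 (lexx _) c cL (eL c cL); apply: contraTneq => ->.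
by rewrite mulr0 ltxx.
Qed.

(** Otherwise the first letter of a reduced word of [c^-1] is a simple root that [c] makes
    negative. *)
Lemma positive_preserving_eq1 c : W c ->
  (forall b, Phi b -> 0 < ht b -> 0 < ht (c *m b)) -> c = 1%:M.
Proof.
move=> Wc cpos; have [[|a r] [rD rE rmin]] := reduced_exists (group_tr Wc).
  by rewrite -[c]trmxK -rE rword_nil trmx1.
have aD : a \in Delta by move/simple_word_cons: (rD) => [].
have [_] := @reduced_inversion [::] a r rD rmin.
rewrite /= rE trmxK rword_nil mul1mx ltNge ltW//; apply: cpos.
  exact: simple_root.
exact: simple_ht_gt0.
Qed.

(** Induction on the number of positive roots negative at [l]: for a simple root [a] among them, [l]
    is reflected in [a] and [c] is conjugated by [reflmx a], until [l] has the signs of the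
    height. *)
Lemma regular_preserving_eq1 l c : W c -> (forall b, Phi b -> dot l b != 0) ->
  (forall b, Phi b -> 0 < dot l b -> 0 < dot l (c *m b)) -> c = 1%:M.
Proof.
have [P Pu PE] := positive_roots_seq.
move: {2}(count _ _) (leqnn (count (fun b => dot l b < 0) P)) => m.
elim: m l c => [|m IH] l c cm Wc lreg lpos.
  have lP b : Phi b -> 0 < ht b -> 0 < dot l b.
    move=> Pb hb; rewrite lt_neqAle eq_sym lreg// leNgt; apply/negP => lb.
    suff : has (fun b => dot l b < 0) P by rewrite has_count ltnNge cm.
    by apply/hasP; exists b => //; apply/PE.
  apply: positive_preserving_eq1 => // b Pb hb; have Pcb := root_mul Wc Pb.
  rewrite ltNge ht_le0//; apply/negP => hcb.
  have := lpos b Pb (lP b Pb hb); apply/negP; rewrite -leNgt -oppr_ge0 -dotNr ltW//.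
  by apply: lP; [exact: rootN | rewrite dotNr oppr_gt0].
have [/hasP[b /PE[Pb hb] lb]|] := boolP (has (fun b => dot l b < 0) P); last first.
  by move=> /negP nl; apply: (IH l) => //; rewrite leqNgt; move: nl; rewrite has_count; lia.
have [a aD la] := simple_exists_lt0 (ht_gt0P Pb hb) lb; have Pa := simple_root aD.
have sa := group_reflmx Pa.
have lE v : dot (reflmx a *m l) v = dot l (reflmx a *m v).
  by rewrite dot_mulr reflmx_tr.
suff : reflmx a *m c *m reflmx a = 1%:M.
  have ss : reflmx a *m reflmx a = 1%:M by rewrite -[X in _ *m X]mulmx1 reflmxK.
  move=> E; have <- : reflmx a *m (reflmx a *m c *m reflmx a) *m reflmx a = c.
    by rewrite -!mulmxA reflmxK ss mulmx1.
  by rewrite E mulmx1.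
apply: (IH (reflmx a *m l)); first last.
- move=> d Pd; rewrite !lE -!mulmxA reflmxK => ld; apply: lpos => //.
  exact: root_reflmx.
- by move=> d Pd; rewrite lE; apply: lreg; exact: root_reflmx.
- by do ?apply: groupM.
rewrite -ltnS; apply: leq_trans cm; rewrite -!size_filter.
pose N := [seq d <- P | dot (reflmx a *m l) d < 0].
(* The reflection in [a] embeds [N] in the positive roots negative at [l], and misses [a]. *)
have -> : (size N).+1 = size (a :: map (mulmx (reflmx a)) N) by rewrite /= size_map.
apply: uniq_leq_size => /=.
  rewrite map_inj_uniq; last exact: can_inj (reflmxK a).
  rewrite filter_uniq// andbT; apply/mapP => -[d].
  rewrite mem_filter => /andP[_ /PE[Pd hd]] aE; move: hd.
  by rewrite -(reflmxK a d) -aE reflmx_self dotNr oppr_gt0 ltNge ltW// simple_ht_gt0.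
move=> d; rewrite inE => /predU1P[->|/mapP[v]].
  by rewrite mem_filter la; apply/PE; rewrite simple_ht_gt0.
rewrite mem_filter lE => /andP[lv /PE[Pv hv]] ->.
rewrite mem_filter lv; apply/PE; split; first exact: root_reflmx.
apply: simple_reflmx_gt0 => //; apply: contraTneq lv => ->.
by rewrite reflmx_self dotNr oppr_lt0 -leNgt ltW.
Qed.

(* Otherwise x y^-1 permutes the roots that are positive at a regular point
   close to a generic point of its fixed space, and so is the identity. *)
Lemma descent_inX x y : W x -> W y -> x != y -> exists b,
  [/\ Phi b, 0 < ht b, inX x y b & ht (x^T *m b) < 0 \/ ht (y^T *m b) < 0].
Proof.
move=> Wx Wy; apply: contra_neqP => nex.
have H b : Phi b -> 0 < ht b -> inX x y b -> 0 < ht (x^T *m b) /\ 0 < ht (y^T *m b).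
  move=> Pb hb bX; split; rewrite ltNge ht_le0; try exact: root_trM.
    by apply/negP => h; apply: nex; exists b; split=> //; left.
  by apply/negP => h; apply: nex; exists b; split=> //; right.
have [P Pu PE] := positive_roots_seq.
have [|e xye eP] := @generic_fixed x y [seq b <- P | ~~ inX x y b].
  by move=> b; rewrite mem_filter => /andP[].
have [eps eps0 /(_ eps eps0 (lexx _)) epsP] := perturb_sign P e l0.
set l := e + eps *: l0 in epsP.
have sgnP b : Phi b -> exists2 b', b' \in P & b = b' \/ b = - b'.
  move=> Pb; have [hb|] := ltP 0 (ht b); first by exists b; [exact/PE | left].
  rewrite ht_le0// => hb; exists (- b); last by right; rewrite opprK.
  by apply/PE; split; [exact: rootN | rewrite dotNr oppr_gt0].
have F1 b : Phi b -> dot e b != 0 -> 0 < dot e b * dot l b.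
  move=> /sgnP[b' /epsP + []->]; rewrite ?dotNr ?oppr_eq0 ?mulrNN !(dotC _ b');
  by move=> /[apply].
have F2 b : Phi b -> dot e b = 0 -> inX x y b.
  move=> /sgnP[b' b'P bE] eb; have b'X : inX x y b'.
    apply/negPn/negP => b'X; have := eP b'; rewrite mem_filter b'X b'P dotC.
    by case: bE eb => ->; rewrite ?dotNr => /eqP; rewrite ?oppr_eq0 => -> /(_ isT).
  by case: bE => ->//; apply: subspaceN => //; exact: subspace_inX.
have F3 b : dot e b = 0 -> dot l b = eps * ht b.
  by move=> eb; rewrite /l dotDl dotZl eb add0r.
have Wc := groupM Wx (group_tr Wy).
have [xo yo] := (group_orth Wx, group_orth Wy).
have ec b : dot e (x *m y^T *m b) = dot e b.
  by rewrite -mulmxA dot_mulr xye -dot_mulr orthKV.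
have c1 : x *m y^T = 1%:M.
  apply: (@regular_preserving_eq1 l) => // b Pb.
    have [eb|eb] := eqVneq (dot e b) 0.
      by rewrite F3// mulf_neq0 ?ht_neq0// gt_eqF.
    by have := F1 b Pb eb; apply: contraTneq => ->; rewrite mulr0 ltxx.
  (* Where [dot e b] is nonzero it decides the sign and [x y^-1] preserves it. Where it vanishes, a
     negative image would have a positive opposite in the moved space, sent by [x^-1] to the
     negative root [- y^-1 b], against [H]. *)
  have Pcb := root_mul Wc Pb; have [eb|eb] := eqVneq (dot e b) 0.
    rewrite !F3// ?ec// !pmulr_rgt0// => hb.
    have [_ yb] := H b Pb hb (F2 b Pb eb).
    rewrite ltNge ht_le0//; apply/negP => hcb.
    have [|||+ _] := H (- (x *m y^T *m b)).
    - exact: rootN.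
    - by rewrite dotNr oppr_gt0.
    - by apply: F2; [exact: rootN | rewrite dotNr ec eb oppr0].
    by rewrite mulmxN -mulmxA orthK// dotNr oppr_gt0 ltNge ltW.
  have := F1 b Pb eb; have := F1 _ Pcb; rewrite ec => /(_ eb).
  have [e0|e0] := ltP 0 (dot e b).
    by rewrite !pmulr_rgt0.
  have e0' : dot e b < 0 by rewrite lt_neqAle eb.
  by rewrite !nmulr_rgt0// => _ h1 /lt_trans/(_ h1); rewrite ltxx.
by rewrite -[x]mulmx1 -yo mulmxA c1 mul1mx.
Qed.
(** * Dihedral crowns *)

(** The columns of [reflmx a *m x - y] and [x - y] differ by multiples of [a]. *)
Lemma inX_reflmx_sub x y a c : inX (reflmx a *m x) y c ->
  exists k, inX x y (c - k *: a).
Proof.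
move=> /submxP[D cD]; pose t := 2 / dot a a.
exists (- (t *: (D *m x^T *m a)) 0 0).
rewrite /inX [(c - _)^T]linearB /= [(_ *: a)^T]linearZ /= cD.
have E : (reflmx a *m x)^T = x^T - t *: (x^T *m a *m a^T).
  by rewrite trmx_mul reflmx_tr /reflmx -/t mulmxBr mulmx1 -scalemxAr mulmxA.
have -> : D *m (reflmx a *m x - y)^T =
    D *m (x - y)^T - (t *: (D *m x^T *m a)) *m a^T.
  rewrite [(_ *m _ - y)^T]linearB /= E [(x - y)^T]linearB /= !mulmxBr addrAC.
  by congr (_ - _); rewrite -scalemxAr -scalemxAl !mulmxA.
rewrite [X in X *m a^T]mx11_scalar mul_scalar_mx scaleNr opprK subrK.
exact: submxMl.
Qed.

Lemma inX_reflmx_self x a c : inX (reflmx a *m x) x c -> exists k, c = k *: a.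
Proof.
by move=> /inX_reflmx_sub[k]; rewrite inX_id subr_eq0 => /eqP; exists k.
Qed.

(** The root [d] joining [p] to [q1] is not in the moved line of [p q2^-1], since [q1] would then be
    [q2]; by Carter's lemma it lies in the moved space of [q1 q2^-1]. *)
Lemma adjacent_sub (p q1 q2 : 'M[R]_n) : W p -> W q1 -> W q2 -> q1 != q2 ->
  rdist q1 p = 1%N -> rdist p q2 = 1%N -> ((q1 - p)^T <= (q1 - q2)^T)%MS.
Proof.
move=> Wp W1 W2 q12 d1 d2.
have [d Pd q1E] := rdist1_root W1 Wp d1.
have [po o2] := (group_orth Wp, group_orth W2).
have dX : ~~ inX p q2 d.
  apply/negP => dX; have := rdist_reflmx_in po o2 (root_neq0 Pd) dX.
  rewrite d2 -q1E => -[/esym/eqP]; rewrite rdist_eq0; exact/negP.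
apply/row_subP => i; rewrite -[row i _]trmxK.
have /inX_reflmx_self[k ->] : inX (reflmx d *m p) p (row i (q1 - p)^T)^T.
  by rewrite /inX trmxK -q1E row_sub.
by apply: inXZ; rewrite q1E; apply: sub_reflmx_notin => //; rewrite eqxx orbT.
Qed.

(** All differences have their columns in the column space of [a1 - a2], of dimension at most two,
    so [rdist x y] is at most two; it is odd because a path of length three joins [x] to [y]. *)
Lemma crown_rdist x y (a1 a2 b1 b2 : 'M[R]_n) :
  W x -> W y -> W a1 -> W a2 -> W b1 -> W b2 -> a1 != a2 -> b1 != b2 ->
  rdist x a1 = 1%N -> rdist x a2 = 1%N -> rdist a1 b1 = 1%N ->
  rdist a1 b2 = 1%N -> rdist a2 b1 = 1%N -> rdist a2 b2 = 1%N ->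
  rdist b1 y = 1%N -> rdist b2 y = 1%N -> rdist x y = 1%N.
Proof.
move=> Wx Wy Wa1 Wa2 Wb1 Wb2 a12 b12 xa1 xa2 a11 a12' a21 a22 b1y b2y.
have sub p : W p -> rdist a1 p = 1%N -> rdist a2 p = 1%N ->
    ((a1 - p)^T <= (a1 - a2)^T)%MS.
  by move=> Wp p1 p2; apply: adjacent_sub => //; rewrite rdist_sym.
have sx : ((a1 - x)^T <= (a1 - a2)^T)%MS by apply: sub => //; rewrite rdist_sym.
have s1 := sub b1 Wb1 a11 a21; have s2 := sub b2 Wb2 a12' a22.
have sb : ((b1 - b2)^T <= (a1 - a2)^T)%MS.
  have -> : (b1 - b2)^T = (a1 - b2)^T - (a1 - b1)^T.
    by apply/matrixP => i j; rewrite !mxE; ring.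
  by rewrite addmx_sub// eqmx_opp.
have sy : ((b1 - y)^T <= (a1 - a2)^T)%MS.
  by apply: submx_trans sb; apply: adjacent_sub => //; rewrite rdist_sym.
have sxy : ((x - y)^T <= (a1 - a2)^T)%MS.
  have -> : (x - y)^T = (b1 - y)^T + (a1 - b1)^T - (a1 - x)^T.
    by apply/matrixP => i j; rewrite !mxE; ring.
  by rewrite addmx_sub// ?eqmx_opp// addmx_sub.
have le2 : (rdist x y <= 2)%N.
  rewrite /rdist -mxrank_tr (leq_trans (mxrankS sxy))// mxrank_tr.
  apply: leq_trans (rdist_triangle a1 x a2) _.
  by rewrite (rdist_sym a1) xa1 xa2.
have : odd (rdist x y).
  by rewrite (odd_rdist Wx Wa1 Wy) (odd_rdist Wa1 Wb1 Wy) xa1 a11 b1y.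
by case: (rdist x y) le2 => [|[|[]]].
Qed.

(** * Inversions counted in a subspace *)

Section PositiveRoots.
Context {P : seq 'cV[R]_n} (Pu : uniq P).
Context (PE : forall a, a \in P <-> Phi a /\ 0 < ht a).

Definition ninv (B : pred 'cV[R]_n) x := count (fun b => B b && (ht (x^T *m b) < 0)) P.

(** The count is reindexed by the involution [psi] of the positive roots, which applies [reflmx a]
    where the result is positive and is the identity elsewhere. The remaining term counts the new
    inversions among the roots fixed by [psi]. *)
Lemma ninv_reflmx B a x : subspace B -> Phi a -> 0 < ht a -> B a -> W x ->
  0 < ht (x^T *m a) ->
  ninv B (reflmx a *m x) = (ninv B x + count (fun b =>
    [&& B b, (ht (reflmx a *m b) < 0)%R, (0 < ht (x^T *m b))%R
      & (ht (x^T *m (reflmx a *m b)) < 0)%R]) P)%N.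
Proof.
move=> Bs Pa ha Ba Wx xa.
pose psi b := if 0 < ht (reflmx a *m b) then reflmx a *m b else b.
have psiK : {in P, forall b, psi (psi b) = b}.
  move=> b /PE[Pb hb]; rewrite /psi.
  have [h|/negPf h] := boolP (0 < ht (reflmx a *m b)); first by rewrite reflmxK hb.
  by rewrite !h.
have psiP : {in P, forall b, psi b \in P}.
  move=> b bP; have [Pb hb] := (PE b).1 bP; rewrite /psi; case: ifP => // h.
  by apply/PE; split=> //; exact: root_reflmx.
have /permP permP : perm_eq (map psi P) P.
  apply: uniq_perm => //.
    by rewrite map_inj_in_uniq// => b c bP cP E; rewrite -(psiK b)// E psiK.
  move=> b; apply/mapP/idP => [[c /psiP + ->]//|bP].
  by exists (psi b); [exact: psiP | rewrite psiK].
rewrite /ninv -permP count_map; apply: count_disjointU => b /PE[Pb hb] /=.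
  have BE : B (reflmx a *m b) = B b.
    apply/idP/idP; last exact: subspace_reflmx.
    by rewrite -{2}(reflmxK a b); exact: subspace_reflmx.
  rewrite /psi trmx_mul reflmx_tr -mulmxA; case: ifPn => h.
    by rewrite BE reflmxK (lt_gtF h) /= andbF orbF.
  rewrite -ht_ltNge in h; last exact: root_reflmx.
  rewrite h /=; case: (B b) => //=; have := ht_neq0 (root_trM Wx Pb).
  case: (ltgtP (ht (x^T *m b)) 0) => //= xb _.
  (* The coefficient [k] of [a] removed by the reflection is positive, so an inversion [b] of [x]
     that the reflection makes negative remains an inversion. *)
  move: h; rewrite reflmxE mulmxBr -scalemxAr !dotBr !dotZr.
  set k := _ / _ => h; have k0 : 0 < k.
    by rewrite -(pmulr_lgt0 _ ha); lra.
  have := mulr_gt0 k0 xa; lra.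
by move=> /andP[_ /lt_gtF ->]; rewrite !andbF.
Qed.

Lemma ninv_lt B a x : subspace B -> Phi a -> 0 < ht a -> B a -> W x ->
  0 < ht (x^T *m a) -> (ninv B x < ninv B (reflmx a *m x))%N.
Proof.
move=> Bs Pa ha Ba Wx xa; rewrite ninv_reflmx// -addn1 leq_add2l -has_count.
apply/hasP; exists a; first exact/PE.
by rewrite Ba reflmx_self mulmxN !dotNr !oppr_lt0 ha xa.
Qed.

Lemma subspace_predT : subspace predT. Proof. by []. Qed.

Lemma edge_ninv x y : W x -> edge x y -> (ninv predT x < ninv predT y)%N.
Proof.
by move=> Wx [b [Pb hb xb ->]]; apply: ninv_lt => //; exact: subspace_predT.
Qed.

Lemma dpath_ninv B k x y : W x -> dpath B k x y ->
  (ninv predT x + k <= ninv predT y)%N.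
Proof.
elim: k x => [|k IH] x Wx; first by move=> ->; rewrite addn0.
move=> [b [Pb hb xb _ /(IH _ (group_reflmxM Pb Wx))]]; apply: leq_trans.
by rewrite addnS -addSn leq_add2r; apply: edge_ninv => //; exists b.
Qed.

Lemma bruhat_le_ninv x y : W x -> bruhat_le W Delta x y -> x != y ->
  (ninv predT x < ninv predT y)%N.
Proof.
move=> Wx /(bruhat_leP _ Wx)[[|k] /=]; first by move=> ->; rewrite eqxx.
move=> /(@dpath_ninv _ k.+1) => /(_ Wx) h _; lia.
Qed.

Lemma bruhat_le_anti x y : W x -> W y -> bruhat_le W Delta x y ->
  bruhat_le W Delta y x -> x = y.
Proof.
move=> Wx Wy xy yx; apply/eqP/negPn/negP => nxy.
have := bruhat_le_ninv Wx xy nxy; rewrite eq_sym in nxy.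
have := bruhat_le_ninv Wy yx nxy; lia.
Qed.

Lemma edge_rdist x y : W x -> edge x y -> rdist x y = 1%N.
Proof. by move=> Wx [b [Pb _ _ ->]]; rewrite rdist_sym rdist_reflmx_root. Qed.

Lemma rdist1_edge x y : W x -> W y -> rdist x y = 1%N -> edge x y \/ edge y x.
Proof.
move=> Wx Wy /(rdist1_root Wx Wy)[b Pb xE].
wlog hb : b Pb xE / 0 < ht b => [H|].
  have [|] := ltP 0 (ht b); first exact: H.
  rewrite ht_le0// => hb; apply: (H (- b)); first exact: rootN.
    by rewrite reflmxN.
  by rewrite dotNr oppr_gt0.
have [yb|] := ltP 0 (ht (y^T *m b)); first by right; exists b.
rewrite ht_le0; last exact: root_trM.
by move=> yb; left; rewrite xE; exact: edge_reflmx.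
Qed.

Lemma rdist1_le_edge x y : W x -> W y -> rdist x y = 1%N ->
  bruhat_le W Delta x y -> edge x y.
Proof.
move=> Wx Wy d1 le; case: (rdist1_edge Wx Wy d1) => // eyx.
have xy : x != y by rewrite -rdist_eq0 d1.
by have := edge_ninv Wy eyx; have := bruhat_le_ninv Wx le xy; lia.
Qed.

Lemma count_le1 a (p : pred 'cV[R]_n) : {in P, forall b, p b -> b = a} ->
  (count p P <= 1)%N.
Proof.
move=> pa; apply: (@leq_trans (count (pred1 a) P)); last first.
  by rewrite count_uniq_mem ?leq_b1.
rewrite -!size_filter; apply: uniq_leq_size; first by rewrite filter_uniq.
by move=> b; rewrite !mem_filter => /andP[pb bP]; rewrite bP /= (pa b bP pb) eqxx.
Qed.

(** An element strictly between forces at least two new inversions, and [a] accounts for only one of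
    them. *)
Lemma noncover_pair a x z : Phi a -> 0 < ht a -> W x -> 0 < ht (x^T *m a) ->
  W z -> x != z -> z != reflmx a *m x -> bruhat_le W Delta x z ->
  bruhat_le W Delta z (reflmx a *m x) ->
  exists b, [/\ [/\ Phi b, 0 < ht b & b != a], ht (reflmx a *m b) < 0,
    0 < ht (x^T *m b) & ht (x^T *m (reflmx a *m b)) < 0].
Proof.
move=> Pa ha Wx xa Wz xz zy xlez zley; apply: contrapT => nb.
have := bruhat_le_ninv Wx xlez xz; have := bruhat_le_ninv Wz zley zy.
rewrite ninv_reflmx//.
suff : (count (fun b => [&& predT b, (ht (reflmx a *m b) < 0)%R,
   (0 < ht (x^T *m b))%R & (ht (x^T *m (reflmx a *m b)) < 0)%R]) P <= 1)%N by lia.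
apply: (@count_le1 a) => b bP /and4P[_ h1 h2 h3].
apply/eqP/negPn/negP => ba; apply: nb; exists b; split=> //.
by have [] := (PE b).1 bP.
Qed.

Definition plane a b : pred 'cV[R]_n :=
  fun v => `[< exists s t, v = s *: a + t *: b >].

Lemma planeP a b v : reflect (exists s t, v = s *: a + t *: b) (plane a b v).
Proof. exact: asboolP. Qed.

Lemma subspace_plane a b : subspace (plane a b).
Proof.
split=> [u v /planeP[s [t ->]] /planeP[s' [t' ->]]|k u /planeP[s [t ->]]].
  by apply/planeP; exists (s + s'), (t + t'); rewrite !scalerDl addrACA.
by apply/planeP; exists (k * s), (k * t); rewrite scalerDr !scalerA.
Qed.

(** On the half-plane of positive height the ratio of [dot kap] to the height orders the rays, and
    [d] maximises it over [D]. If [g + g'] is a multiple of [d], then [g] attains the maximum too,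
    hence lies on the line of [d] and equals it. *)
Lemma plane_extreme a b kap (D : seq 'cV[R]_n) (g0 : 'cV[R]_n) :
  Phi a -> 0 < ht a ->
  dot kap a = 0 -> {subset D <= P} -> {in D, forall v, plane a b v} ->
  g0 \in D -> 0 < dot kap g0 -> exists d, [/\ d \in D, 0 < dot kap d
   & forall (g g' : 'cV[R]_n) s, g \in D -> g' \in D -> g != d -> g + g' = s *: d -> False].
Proof.
move=> Pa ha ka DP Dpl g0D kg0.
have Dh (g : 'cV[R]_n) : g \in D -> Phi g /\ 0 < ht g by move=> /DP/PE.
have [d dD dmax] := seq_argmax (fun g : 'cV[R]_n => dot kap g / ht g) g0D.
have [Pd hd] := Dh d dD; set sg := dot kap d / ht d.
have sg0 : 0 < sg.
  apply: lt_le_trans (dmax _ g0D); rewrite divr_gt0//; exact: (Dh _ g0D).2.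
have kd : dot kap d = sg * ht d by rewrite /sg divfK// gt_eqF.
exists d; split=> //; first by rewrite kd mulr_gt0.
have kle (g : 'cV[R]_n) : g \in D -> dot kap g <= sg * ht g.
  by move=> gD; have := dmax g gD; rewrite ler_pdivrMr//; exact: (Dh _ gD).2.
move=> g g' s gD g'D gd gE.
have kg : dot kap g = sg * ht g.
  have /eqP := congr1 (dot kap) gE; have /eqP := congr1 ht gE.
  rewrite !dotDr !dotZr kd => /eqP E1 /eqP E2; have := kle g gD; have := kle g' g'D.
  have : s * (sg * ht d) = sg * (ht g + ht g') by rewrite E1; ring.
  by rewrite -E2 mulrDr; lra.
have /planeP[x1 [y1 g1]] := Dpl g gD; have /planeP[x2 [y2 d2]] := Dpl d dD.
(* A linear form vanishing at [g] and [d] but not at [a]; its kernel in the plane is a line. *)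
pose m v := dot kap v - sg * ht v.
have mD u v s1 t1 : m (s1 *: u + t1 *: v) = s1 * m u + t1 * m v.
  by rewrite /m !dotDr !dotZr; ring.
have ma : m a != 0 by rewrite /m ka sub0r oppr_eq0 mulf_neq0// gt_eqF.
have mg : x1 * m a + y1 * m b = 0 by rewrite -mD -g1 /m kg subrr.
have md : x2 * m a + y2 * m b = 0 by rewrite -mD -d2 /m kd subrr.
have y20 : y2 != 0.
  apply: contraTneq hd => y20; move: md; rewrite y20 mul0r addr0 => /eqP.
  rewrite mulf_eq0 (negPf ma) orbF => /eqP x20.
  by rewrite d2 x20 y20 !scale0r addr0 dot0r ltxx.
have gk : g = (y1 / y2) *: d.
  rewrite g1 d2 scalerDr !scalerA divfK//; congr (_ *: _ + _).
  apply: (mulIf ma); have -> : x1 * m a = - (y1 * m b) by lra.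
  have x2m : x2 * m a = - (y2 * m b) by lra.
  have -> : y1 / y2 * x2 * m a = y1 / y2 * (x2 * m a) by ring.
  by rewrite x2m; field.
have [Pg hg] := Dh g gD; move: (gk); rewrite gk in Pg.
case: (rootZ Pd Pg) => E; rewrite E => gE'; first by rewrite gE' eqxx in gd.
by move: hg; rewrite gE' dotNr oppr_gt0 ltNge ltW.
Qed.

Definition extreme (D : seq 'cV[R]_n) (d : 'cV[R]_n) : Prop :=
  forall (u v : 'cV[R]_n) s, u \in D -> v \in D -> u != d -> u + v = s *: d -> False.

Lemma reflmx_addN (d u : 'cV[R]_n) : exists s, u + - (reflmx d *m u) = s *: d.
Proof. by rewrite reflmxE opprB addrCA subrr addr0; eexists. Qed.

(** A new inversion [u] other than [d] would come with [- (reflmx d *m u)], also in the list, and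
    their sum is a multiple of [d], against extremality. *)
Lemma ninv_extreme_up B d x : subspace B -> Phi d -> 0 < ht d -> B d -> W x ->
  0 < ht (x^T *m d) -> extreme [seq u <- P | B u && (0 < ht (x^T *m u))] d ->
  ninv B (reflmx d *m x) = (ninv B x).+1.
Proof.
move=> Bs Pd hd Bd Wx xd ext.
apply/eqP; rewrite eqn_leq ninv_lt// andbT ninv_reflmx// -[(ninv B x).+1]addn1 leq_add2l.
apply: (@count_le1 d) => u uP /and4P[Bu h1 h2 h3].
have [Pu0 hu] := (PE u).1 uP.
apply/eqP/negPn/negP => ud; have [s sE] := reflmx_addN d u.
apply: (ext u (- (reflmx d *m u)) s) => //; rewrite mem_filter ?Bu ?h2//.
rewrite mulmxN dotNr oppr_gt0 h3 (subspaceN Bs) ?subspace_reflmx//=.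
by apply/PE; split; [apply: rootN; exact: root_reflmx | rewrite dotNr oppr_gt0].
Qed.

Lemma ninv_extreme_down B d x : subspace B -> Phi d -> 0 < ht d -> B d -> W x ->
  ht (x^T *m d) < 0 -> extreme [seq u <- P | B u && (ht (x^T *m u) < 0)] d ->
  ninv B x = (ninv B (reflmx d *m x)).+1.
Proof.
move=> Bs Pd hd Bd Wx xd ext; have Wz := group_reflmxM Pd Wx.
set z := reflmx d *m x in Wz *; have -> : x = reflmx d *m z by rewrite reflmxK.
have zd : 0 < ht (z^T *m d) by rewrite ht_reflmx_tr oppr_gt0.
apply/eqP; rewrite eqn_leq ninv_lt// andbT ninv_reflmx// -[(ninv B z).+1]addn1 leq_add2l.
apply: (@count_le1 d) => u uP /and4P[Bu h1 h2 h3].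
have [Pu0 hu] := (PE u).1 uP.
apply/eqP/negPn/negP => ud; have [s sE] := reflmx_addN d u.
move: h2 h3; rewrite /z trmx_mul reflmx_tr -!mulmxA reflmxK => h2 h3.
apply: (ext u (- (reflmx d *m u)) s) => //; rewrite mem_filter ?Bu ?h3//.
rewrite mulmxN dotNr oppr_lt0 h2 (subspaceN Bs) ?subspace_reflmx//=.
by apply/PE; split; [apply: rootN; exact: root_reflmx | rewrite dotNr oppr_gt0].
Qed.

Lemma plane_gen a b (c d kap : 'cV[R]_n) : dot kap a = 0 -> plane a b c ->
  dot kap c != 0 -> plane a b d -> exists s t, d = s *: a + t *: c.
Proof.
move=> ka /planeP[x1 [y1 cE]] kc /planeP[x2 [y2 ->]].
have y10 : y1 != 0.
  apply: contraNneq kc => y10; rewrite cE y10 scale0r addr0 dotZr ka mulr0 //.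
exists (x2 - y2 / y1 * x1), (y2 / y1).
rewrite cE scalerDr !scalerA divfK// scalerBl addrA subrK //.
Qed.

Lemma pos_root_reflmx_inj a b : Phi a -> Phi b -> 0 < ht a -> 0 < ht b ->
  reflmx a = reflmx b -> a = b.
Proof.
move=> Pa Pb ha hb /(root_reflmx_inj Pa Pb)[//|E].
by move: hb; rewrite E dotNr oppr_gt0 ltNge ltW.
Qed.

Lemma reflmxM_inj x a b : W x -> reflmx a *m x = reflmx b *m x -> reflmx a = reflmx b.
Proof.
move=> Wx /(congr1 (mulmx^~ x^T)); rewrite -!mulmxA orthV ?mulmx1//.
exact: group_orth.
Qed.

(* All four elements lie in one dihedral coset, so p and q differ by a product
   of three reflections of a dihedral group, hence by a reflection. *)
Lemma dihedral_edge a b (d c kap : 'cV[R]_n) x : W x ->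
  Phi a -> 0 < ht a -> plane a b a -> dot kap a = 0 ->
  Phi d -> plane a b d ->
  Phi c -> 0 < ht c -> plane a b c -> dot kap c != 0 ->
  forall p q : 'M[R]_n, p = reflmx d *m x -> q = reflmx c *m (reflmx a *m x) ->
  (ninv (plane a b) p < ninv (plane a b) q)%N -> edge p q.
Proof.
move=> Wx Pa ha Ba ka Pd Bd Pc hc Bc kc p q pdef qdef pq.
have Wy := group_reflmxM Pa Wx; have [y ydef] : exists y, y = reflmx a *m x by eexists.
rewrite -ydef in Wy qdef.
have Wq : W q by rewrite qdef; exact: group_reflmxM.
have Wp : W p by rewrite pdef; exact: group_reflmxM.
have [xo yo qo] := And3 (group_orth Wx) (group_orth Wy) (group_orth Wq).
have yE : y = reflmx c *m q by rewrite qdef reflmxK.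
have xE : x = reflmx a *m y by rewrite ydef reflmxK.
have yq : rdist y q = 1%N by rewrite yE rdist_reflmx_root.
have cyq : inX y q c.
  rewrite yE; apply: sub_reflmx_notin => //; last by rewrite eqxx orbT.
  by rewrite inX_id; exact: root_neq0.
have ayq : ~~ inX y q a.
  apply/negP => /(rdist_reflmx_in yo qo (root_neq0 Pa)); rewrite yq -xE => -[/esym/eqP].
  rewrite rdist_eq0 xE qdef => /eqP/(reflmxM_inj Wy).
  move=> /(pos_root_reflmx_inj Pa Pc ha hc) ac.
  by move: kc; rewrite -ac ka eqxx.
have xq : rdist x q = 2%N by rewrite xE rdist_reflmx_notin// yq.
(* The moved space of [x q^-1] contains [a] and [c], which span the plane, hence also [d]. *)
have dX : inX x q d.
  have [s [t ->]] := plane_gen ka Bc kc Bd.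
  by rewrite xE; apply: inXD; apply: inXZ; apply: sub_reflmx_notin => //;
    rewrite ?cyq ?eqxx ?orbT.
have pq1 : rdist p q = 1%N.
  by have := rdist_reflmx_in xo qo (root_neq0 Pd) dX; rewrite xq -pdef => -[].
(* An edge from [q] to [p] would have its label in the plane and contradict the comparison of
   inversion counts there. *)
case: (rdist1_edge Wp Wq pq1) => // -[e [Pe he qe pE]].
have eX : inX p q e.
  rewrite pE; apply: sub_reflmx_notin => //; last by rewrite eqxx orbT.
  by rewrite inX_id; exact: root_neq0.
have Be : plane a b e.
  rewrite pdef in eX; have := sub_reflmx_in xo qo (root_neq0 Pd) dX eX.
  rewrite {1}xE => /inX_reflmx_sub[k]; rewrite {1}yE => /inX_reflmx_self[k' E].
  have -> : e = k' *: c + k *: a by rewrite -E subrK.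
  have Bs := subspace_plane a b.
  by apply: Bs.1; apply: Bs.2.
by have := ninv_lt (subspace_plane a b) Pe he Be Wq qe; rewrite -pE ltnNge ltnW.
Qed.

(** In the plane of [a] and a second new inversion [b], the extreme roots on either side of [a] lead
    from [x] to [p1], [p2] and down from the upper end to [q1], [q2]. These steps change the
    inversion count of the plane by one and the total change is at least three, so each [p] is
    joined upwards to each [q]. *)
Lemma crown a x z : Phi a -> 0 < ht a -> W x -> 0 < ht (x^T *m a) ->
  W z -> x != z -> z != reflmx a *m x -> bruhat_le W Delta x z ->
  bruhat_le W Delta z (reflmx a *m x) ->
  exists p1 p2 q1 q2 : 'M[R]_n, [/\ p1 != p2, q1 != q2, edge x p1 /\ edge x p2,
    [/\ edge p1 q1, edge p1 q2, edge p2 q1 & edge p2 q2]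
    & edge q1 (reflmx a *m x) /\ edge q2 (reflmx a *m x)].
Proof.
move=> Pa ha Wx xa Wz xz zy xlez zley.
have [b [[Pb hb ba] sab xb xsb]] := noncover_pair Pa ha Wx xa Wz xz zy xlez zley.
have Wy := group_reflmxM Pa Wx; set y := reflmx a *m x in Wy *.
set b' := - (reflmx a *m b).
have Pb' : Phi b' by apply: rootN; exact: root_reflmx.
have hb' : 0 < ht b' by rewrite dotNr oppr_gt0.
have xb' : 0 < ht (x^T *m b') by rewrite mulmxN dotNr oppr_gt0.
have yb : ht (y^T *m b) < 0 by rewrite trmx_mul reflmx_tr -mulmxA.
have yb' : ht (y^T *m b') < 0.
  by rewrite trmx_mul reflmx_tr -mulmxA mulmxN reflmxK mulmxN dotNr oppr_lt0.
have ya : ht (y^T *m a) < 0 by rewrite ht_reflmx_tr oppr_lt0.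
have bb' : b != b'.
  apply: contra ba => /eqP bE; have [s sE] := reflmx_addN a b.
  rewrite -/b' -bE in sE; have bK : b = (s / 2) *: a.
    apply: (@scalerI _ _ (2 : R)); first by rewrite pnatr_eq0.
    by rewrite scalerA mulrC divfK ?pnatr_eq0// -sE scaler_nat mulr2n.
  rewrite bK in Pb *; case: (rootZ Pa Pb) => [->//|E].
  by move: hb; rewrite bK E dotNr oppr_gt0 ltNge ltW.
pose B := plane a b; have Bs : subspace B := subspace_plane a b.
have Ba : B a by apply/planeP; exists 1, 0; rewrite scale1r scale0r addr0.
have Bb : B b by apply/planeP; exists 0, 1; rewrite scale1r scale0r add0r.
have Bb' : B b' by apply: (subspaceN Bs); exact: subspace_reflmx.
(* A direction orthogonal to [a], with [b] on its positive side and the mirror root [b'] on its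
   negative side. *)
pose kap := b - b'.
have ka : dot kap a = 0.
  rewrite /kap /b' opprK dotDl (dotC (_ *m _)) dot_mulr reflmx_tr reflmx_self dotNl.
  by rewrite dotC subrr.
have norm : dot b' b' = dot b b.
  by rewrite /b' dotNl dotNr opprK orth_dot//; exact: orth_reflmx.
have kk : 0 < dot kap kap by rewrite dot_gt0// subr_eq0.
have kb : 0 < dot kap b.
  by move: kk; rewrite /kap dotBr !dotBl norm (dotC b' b); lra.
have kb' : dot kap b' < 0.
  by move: kk; rewrite /kap dotBr !dotBl norm (dotC b' b); lra.
have Nka : dot (- kap) a = 0 by rewrite dotNl ka oppr0.
have Nkb' : 0 < dot (- kap) b' by rewrite dotNl oppr_gt0.
pose Dx := [seq u <- P | B u && (0 < ht (x^T *m u))].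
pose Dy := [seq u <- P | B u && (ht (y^T *m u) < 0)].
have subP (q : pred 'cV[R]_n) : {subset [seq u <- P | B u && q u] <= P}.
  by move=> u; rewrite mem_filter => /andP[].
have subB (q : pred 'cV[R]_n) : {in [seq u <- P | B u && q u], forall u, plane a b u}.
  by move=> u; rewrite mem_filter => /andP[/andP[]].
have bP : b \in P by exact/PE.
have b'P : b' \in P by exact/PE.
have [d1 [d1D kd1 ext1]] : exists d, [/\ d \in Dx, 0 < dot kap d & extreme Dx d].
  apply: (plane_extreme Pa ha ka (@subP _) (@subB _) _ kb).
  by rewrite mem_filter Bb xb.
have [d2 [d2D kd2 ext2]] : exists d, [/\ d \in Dx, 0 < dot (- kap) d & extreme Dx d].
  apply: (plane_extreme Pa ha Nka (@subP _) (@subB _) _ Nkb').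
  by rewrite mem_filter Bb' xb'.
have [c1 [c1D kc1 ext3]] : exists d, [/\ d \in Dy, 0 < dot kap d & extreme Dy d].
  apply: (plane_extreme Pa ha ka (@subP _) (@subB _) _ kb).
  by rewrite mem_filter Bb yb.
have [c2 [c2D kc2 ext4]] : exists d, [/\ d \in Dy, 0 < dot (- kap) d & extreme Dy d].
  apply: (plane_extreme Pa ha Nka (@subP _) (@subB _) _ Nkb').
  by rewrite mem_filter Bb' yb'.
have inDx (d : 'cV[R]_n) : d \in Dx -> [/\ B d, 0 < ht (x^T *m d), Phi d & 0 < ht d].
  by rewrite mem_filter => /andP[/andP[? ?] /PE[? ?]]; split.
have inDy (d : 'cV[R]_n) : d \in Dy -> [/\ B d, ht (y^T *m d) < 0, Phi d & 0 < ht d].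
  by rewrite mem_filter => /andP[/andP[? ?] /PE[? ?]]; split.
have [Bd1 xd1 Pd1 hd1] := inDx _ d1D; have [Bd2 xd2 Pd2 hd2] := inDx _ d2D.
have [Bc1 yc1 Pc1 hc1] := inDy _ c1D; have [Bc2 yc2 Pc2 hc2] := inDy _ c2D.
have n1 : ninv B (reflmx d1 *m x) = (ninv B x).+1 by exact: ninv_extreme_up.
have n2 : ninv B (reflmx d2 *m x) = (ninv B x).+1 by exact: ninv_extreme_up.
have n3 : ninv B y = (ninv B (reflmx c1 *m y)).+1 by exact: ninv_extreme_down.
have n4 : ninv B y = (ninv B (reflmx c2 *m y)).+1 by exact: ninv_extreme_down.
have n5 : (ninv B x + 3 <= ninv B y)%N.
  rewrite ninv_reflmx// leq_add2l -size_filter.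
  have -> : 3%N = size [:: a; b; b'] by [].
  apply: uniq_leq_size.
    rewrite /= !inE negb_or (eq_sym a b) ba bb' !andbT /=.
    by apply: contraTneq kb' => <-; rewrite ka ltxx.
  move=> u; rewrite !inE => /or3P[]/eqP->; rewrite mem_filter.
  - rewrite Ba reflmx_self mulmxN !dotNr !oppr_lt0 ha xa /=; exact/PE.
  - by rewrite Bb sab xb xsb.
  - by rewrite Bb' xb' b'P /b' mulmxN reflmxK mulmxN !dotNr !oppr_lt0 hb xb.
have [e11 e12 e21 e22] : [/\ ninv B (reflmx d1 *m x) < ninv B (reflmx c1 *m y),
    ninv B (reflmx d1 *m x) < ninv B (reflmx c2 *m y),
    ninv B (reflmx d2 *m x) < ninv B (reflmx c1 *m y) &
    ninv B (reflmx d2 *m x) < ninv B (reflmx c2 *m y)]%N.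
  by clear -n1 n2 n3 n4 n5; split; lia.
have k0 (c : 'cV[R]_n) : 0 < dot kap c -> dot kap c != 0 by move=> /gt_eqF ->.
have k0' (c : 'cV[R]_n) : 0 < dot (- kap) c -> dot kap c != 0.
  by rewrite dotNl oppr_gt0 => /lt_eqF ->.
have neq (u v : 'cV[R]_n) : Phi u -> Phi v -> 0 < ht u -> 0 < ht v -> 0 < dot kap u ->
    0 < dot (- kap) v -> forall t, W t -> reflmx u *m t != reflmx v *m t.
  move=> Pu0 Pv hu hv ku kv t Wt; apply/eqP => /(reflmxM_inj Wt).
  move=> /(pos_root_reflmx_inj Pu0 Pv hu hv) uv.
  by move: kv; rewrite -uv dotNl oppr_gt0 ltNge ltW.
exists (reflmx d1 *m x), (reflmx d2 *m x), (reflmx c1 *m y), (reflmx c2 *m y); split.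
- exact: neq.
- exact: neq.
- by split; [exists d1 | exists d2].
- split.
  + exact: (dihedral_edge Wx Pa ha Ba ka Pd1 Bd1 Pc1 hc1 Bc1 (k0 _ kc1) erefl erefl e11).
  + exact: (dihedral_edge Wx Pa ha Ba ka Pd1 Bd1 Pc2 hc2 Bc2 (k0' _ kc2) erefl erefl e12).
  + exact: (dihedral_edge Wx Pa ha Ba ka Pd2 Bd2 Pc1 hc1 Bc1 (k0 _ kc1) erefl erefl e21).
  + exact: (dihedral_edge Wx Pa ha Ba ka Pd2 Bd2 Pc2 hc2 Bc2 (k0' _ kc2) erefl erefl e22).
- by split; exact: edge_reflmx.
Qed.

(** * Poset isomorphisms *)

Section Transport.
Context (w1 w2 : 'M[R]_n) (f : 'M[R]_n -> 'M[R]_n).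
Context (Ww1 : W w1) (Ww2 : W w2).
Local Notation I1 := (bruhat_ideal W Delta w1).
Local Notation I2 := (bruhat_ideal W Delta w2).
Local Notation le := (bruhat_le W Delta).
Context (fbij : set_bij I1 I2 f).
Context (fle : forall u v : 'M[R]_n, I1 u -> I1 v -> (le u v <-> le (f u) (f v))).

Lemma ideal_down x y : W x -> le x y -> I1 y -> I1 x.
Proof. by move=> Wx xy [Wy yw]; split=> //; exact: rt_trans xy yw. Qed.

Lemma iso_ideal x : I1 x -> I2 (f x).
Proof. by case: fbij => + _ _; apply. Qed.

Lemma iso_inj x y : I1 x -> I1 y -> f x = f y -> x = y.
Proof. by case: fbij => _ + _ xI yI; apply; rewrite inE. Qed.

Lemma iso_surj y : I2 y -> exists2 x, I1 x & f x = y.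
Proof. by case: fbij => _ _ + yI => /(_ y yI). Qed.

(** Induction on the difference of inversion counts. An edge that is not a cover closes a crown of
    shorter edges, whose image is a crown, so the ends of the image differ by a reflection. A cover
    is mapped to a cover, which is an edge. *)
Lemma iso_edge x y : I1 x -> I1 y -> edge x y -> edge (f x) (f y).
Proof.
move: {2}(ninv predT y - ninv predT x)%N (leqnn (ninv predT y - ninv predT x)) => m.
elim: m x y => [|m IH] x y xym xI yI exy.
  by have := edge_ninv xI.1 exy; lia.
have [Wx xw] := xI; have [Wy yw] := yI.
have [Wfx fxw] := iso_ideal xI; have [Wfy fyw] := iso_ideal yI.
have xy := edge_bruhat_le Wx exy; have fxy := (fle xI yI).1 xy.
have [[z [Wz xz zy xlez zley]]|cov] := pselect (exists z,
  [/\ W z, x != z, z != y, le x z & le z y]).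
  case: exy => a [Pa ha xa yE]; rewrite yE in zy zley.
  have [p1 [p2 [q1 [q2 [p12 q12 [xp1 xp2] [e11 e12 e21 e22] [q1y q2y]]]]]] :=
    crown Pa ha Wx xa Wz xz zy xlez zley.
  rewrite -yE in q1y q2y.
  have Wp1 := edge_group Wx xp1; have Wp2 := edge_group Wx xp2.
  have Wq1 := edge_group Wp1 e11; have Wq2 := edge_group Wp1 e12.
  have q1I : I1 q1 by apply: ideal_down yI => //; exact: edge_bruhat_le.
  have q2I : I1 q2 by apply: ideal_down yI => //; exact: edge_bruhat_le.
  have p1I : I1 p1 by apply: ideal_down q1I => //; exact: edge_bruhat_le.
  have p2I : I1 p2 by apply: ideal_down q1I => //; exact: edge_bruhat_le.
  have := edge_ninv Wx xp1; have := edge_ninv Wx xp2; have := edge_ninv Wp1 e11.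
  have := edge_ninv Wp1 e12; have := edge_ninv Wp2 e21; have := edge_ninv Wp2 e22.
  have := edge_ninv Wq1 q1y; have := edge_ninv Wq2 q2y => l1 l2 l3 l4 l5 l6 l7 l8.
  have adj (u v : 'M[R]_n) : I1 u -> I1 v -> edge u v ->
      (ninv predT v - ninv predT u < ninv predT y - ninv predT x)%N ->
      rdist (f u) (f v) = 1%N.
    move=> uI vI euv lt; apply: edge_rdist; first exact: (iso_ideal uI).1.
    by apply: IH => //; lia.
  apply: rdist1_le_edge => //.
  have fp12 : f p1 != f p2 by apply: contra p12 => /eqP/(iso_inj p1I p2I) ->.
  have fq12 : f q1 != f q2 by apply: contra q12 => /eqP/(iso_inj q1I q2I) ->.
  have dxp1 := adj x p1 xI p1I xp1 ltac:(clear -l1 l2 l3 l4 l5 l6 l7 l8; lia).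
  have dxp2 := adj x p2 xI p2I xp2 ltac:(clear -l1 l2 l3 l4 l5 l6 l7 l8; lia).
  have d11 := adj p1 q1 p1I q1I e11 ltac:(clear -l1 l2 l3 l4 l5 l6 l7 l8; lia).
  have d12 := adj p1 q2 p1I q2I e12 ltac:(clear -l1 l2 l3 l4 l5 l6 l7 l8; lia).
  have d21 := adj p2 q1 p2I q1I e21 ltac:(clear -l1 l2 l3 l4 l5 l6 l7 l8; lia).
  have d22 := adj p2 q2 p2I q2I e22 ltac:(clear -l1 l2 l3 l4 l5 l6 l7 l8; lia).
  have dq1 := adj q1 y q1I yI q1y ltac:(clear -l1 l2 l3 l4 l5 l6 l7 l8; lia).
  have dq2 := adj q2 y q2I yI q2y ltac:(clear -l1 l2 l3 l4 l5 l6 l7 l8; lia).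
  have [Wfp1 _] := iso_ideal p1I; have [Wfp2 _] := iso_ideal p2I.
  have [Wfq1 _] := iso_ideal q1I; have [Wfq2 _] := iso_ideal q2I.
  exact: (crown_rdist Wfx Wfy Wfp1 Wfp2 Wfq1 Wfq2).
(* Here nothing lies strictly between [x] and [y]. The first edge of a path from [f x] to [f y] ends
   at some [f z] with [x < z <= y], so [z = y] and this edge is the image. *)
have [[|k]] := (bruhat_leP _ Wfx).1 fxy.
  move=> /= /(iso_inj xI yI) E; case: exy => b [Pb hb xb] yE.
  by have := edge_ninv Wx (ex_intro _ b (And4 Pb hb xb yE)); rewrite E ltnn.
move=> [b [Pb hb xb _ p]].
have e : edge (f x) (reflmx b *m f x) by exists b.
have Wz' := edge_group Wfx e; set z' := reflmx b *m f x in e Wz' p.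
have z'y : le z' (f y) by apply/bruhat_leP => //; exists k.
have z'I : I2 z' by split=> //; exact: rt_trans z'y fyw.
have [z zI zE] := iso_surj z'I.
have [-> |zy] := eqVneq y z; first by rewrite zE.
case: cov; exists z; split; first exact: zI.1.
- apply/eqP => xz; have := edge_ninv Wfx e; rewrite -zE -xz ltnn //.
- by rewrite eq_sym.
- by apply/(fle xI zI); rewrite zE; exact: edge_bruhat_le.
- by apply/(fle zI yI); rewrite zE.
Qed.

(** From [x] or from [y] one can descend along a root of the moved space; this stays in the ideal
    and lowers the distance by one, and the edge used is mapped to an edge. *)
Lemma iso_rdist x y : I1 x -> I1 y -> (rdist (f x) (f y) <= rdist x y)%N.
Proof.
move: {2}(rdist x y) (leqnn (rdist x y)) => m; elim: m x y => [|m IH] x y.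
  rewrite leqn0 rdist_eq0 => /eqP -> _ _; by rewrite /rdist !subrr !mxrank0.
have [-> _ _ _|xy] := eqVneq x y; first by rewrite /rdist !subrr !mxrank0.
move=> xym xI yI; have [Wx _] := xI; have [Wy _] := yI.
have step (u v : 'M[R]_n) b : I1 u -> I1 v -> (rdist u v <= m.+1)%N -> Phi b -> 0 < ht b ->
    inX u v b -> ht (u^T *m b) < 0 -> (rdist (f u) (f v) <= rdist u v)%N.
  move=> uI vI uvm Pb hb bX ub; have [Wu _] := uI; have [Wv _] := vI.
  have Wz := group_reflmxM Pb Wu; have e := edge_reflmx Wu Pb hb ub.
  have zI : I1 (reflmx b *m u) by apply: ideal_down uI => //; exact: edge_bruhat_le.
  have dE := rdist_reflmx_in (group_orth Wu) (group_orth Wv) (root_neq0 Pb) bX.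
  apply: leq_trans (rdist_triangle _ (f (reflmx b *m u)) _) _.
  rewrite rdist_sym (edge_rdist (iso_ideal zI).1 (iso_edge zI uI e)) dE ltnS.
  by apply: IH => //; rewrite -ltnS -dE.
have [b [Pb hb bX [xb|yb]]] := descent_inX Wx Wy xy; first exact: step bX xb.
rewrite rdist_sym [in leqRHS]rdist_sym; apply: step yb => //.
  by rewrite rdist_sym.
by rewrite inX_sym.
Qed.

Lemma iso_top : f w1 = w2.
Proof.
have w1I : I1 w1 by split=> //; exact: rt_refl.
have w2I : I2 w2 by split=> //; exact: rt_refl.
have [v vI vE] := iso_surj w2I; have [Wf fw] := iso_ideal w1I.
apply: bruhat_le_anti => //; rewrite -vE; apply/(fle vI w1I); exact: vI.2.
Qed.

Lemma iso_dpath k x : I1 x -> dpath predT k x w1 -> dpath predT k (f x) w2.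
Proof.
rewrite -iso_top; elim: k x => [|k IH] x xI /=; first by move=> ->.
move=> [b [Pb hb xb _ p]]; have [Wx xw] := xI.
have Wz := group_reflmxM Pb Wx.
have zI : I1 (reflmx b *m x) by split=> //; apply/bruhat_leP => //; exists k.
have [c [Pc hc xc zE]] : edge (f x) (f (reflmx b *m x)).
  by apply: iso_edge => //; exists b.
by exists c; split=> //; rewrite -zE; exact: IH.
Qed.

End Transport.

Definition geodesic w : Prop :=
  forall u, bruhat_ideal W Delta w u -> dpath predT (rdist u w) u w.

(** The image of a geodesic is a path from [u] of length [rdist (g u) w1]. This bounds [rdist u w2]
    from above, and the inverse isomorphism [g] gives the other inequality. *)
Lemma geodesic_iso w1 w2 : W w1 -> W w2 ->
  poset_isomorphic (bruhat_le W Delta) (bruhat_le W Delta)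
    (bruhat_ideal W Delta w1) (bruhat_ideal W Delta w2) ->
  geodesic w1 -> geodesic w2.
Proof.
move=> Ww1 Ww2 [f fbij fle] geo u uI.
have [g gbij gK] : exists2 g : 'M[R]_n -> 'M[R]_n,
    set_bij (bruhat_ideal W Delta w2) (bruhat_ideal W Delta w1) g &
    forall x, bruhat_ideal W Delta w2 x -> f (g x) = x.
  exact: set_bij_inverse fbij.
have gle x y : bruhat_ideal W Delta w2 x -> bruhat_ideal W Delta w2 y ->
    bruhat_le W Delta x y <-> bruhat_le W Delta (g x) (g y).
  move=> xI yI; rewrite -{1}(gK x xI) -{1}(gK y yI).
  have [gx gy] := (iso_ideal gbij xI, iso_ideal gbij yI).
  by split=> /(fle _ _ gx gy).
have vI := iso_ideal gbij uI.
have p := iso_dpath Ww1 Ww2 fbij fle vI (geo _ vI); rewrite gK// in p.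
suff -> : rdist u w2 = rdist (g u) w1 by [].
have w2I : bruhat_ideal W Delta w2 w2 by split=> //; exact: rt_refl.
have := iso_rdist gbij gle uI w2I; rewrite (iso_top Ww2 Ww1 gbij gle) => le.
by apply/eqP; rewrite eqn_leq (dpath_rdist uI.1 p).
Qed.

(** * Comparing the regions with the ideal *)

Lemma arrangement_complementE w L : W w -> inversion_seq w L ->
  arrangement_complement Phi Delta w = off_hyperplanes L.
Proof.
move=> Ww hL; apply/seteqP; split=> v vP.
  move=> b bL; apply/eqP => bv; apply: vP; exists (hyperplane b) => //.
  have [Pb hb wb] := (hL.1 b).1 bL.
  by exists b => //; split; [exact/positive_rootsP | exact/inversionsP].
move=> [_ [b [/positive_rootsP[Pb hb] /(inversionsP Ww Pb hb) wb] <-]] bv.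
by have /eqP := vP b ((hL.1 b).2 (And3 Pb hb wb)).
Qed.

Lemma card_reg w L : W w -> inversion_seq w L ->
  (reg Phi Delta w #= `I_(size (nbc_products w L)))%card.
Proof.
move=> Ww hL; rewrite /reg (arrangement_complementE Ww hL).
exact: card_components (group_orth Ww).
Qed.

Lemma nbc_ideal w L u : W w -> inversion_seq w L -> u \in nbc_products w L ->
  bruhat_ideal W Delta w u.
Proof.
move=> Ww hL uL; have Wu := nbc_group Ww (inversion_seq_root hL) uL.
split=> //; apply/bruhat_leP => //; exists (rdist u w); exact: (nbc_dpath Ww hL).
Qed.

(** The products lie in the ideal and are as many as the regions; one more element in the ideal
    would break the equality of cardinals. *)
Lemma ideal_nbc w L : W w -> inversion_seq w L ->
  (reg Phi Delta w #= bruhat_ideal W Delta w)%card ->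
  forall u, bruhat_ideal W Delta w u -> u \in nbc_products w L.
Proof.
move=> Ww hL regI u uI; apply/negPn/negP => uL.
have us : uniq (u :: nbc_products w L).
  by rewrite /= uL nbc_uniq//; exact: inversion_seq_root hL.
have : (`I_(size (u :: nbc_products w L)) #<= `I_(size (nbc_products w L)))%card.
  rewrite -(card_le_eql (card_seq_set 0 us)) -(card_le_eqr (card_reg Ww hL)).
  rewrite (card_le_eqr regI); apply: subset_card_le => x /=.
  by rewrite inE => /predU1P[->//|]; exact: nbc_ideal.
by rewrite card_le_II ltnn.
Qed.

Lemma card_ideal_le w L : W w -> inversion_seq w L ->
  (forall u, bruhat_ideal W Delta w u -> u \in nbc_products w L) ->
  (bruhat_ideal W Delta w #<= reg Phi Delta w)%card.
Proof.
move=> Ww hL H; rewrite (card_le_eqr (card_reg Ww hL)).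
have us := nbc_uniq Ww (inversion_seq_root hL).
rewrite -(card_le_eqr (card_seq_set 0 us)); apply: subset_card_le => u; exact: H.
Qed.

End PositiveRoots.
End Height.
End Roots.

Theorem theorem3p4 (R : realType) (n : nat) (W : set 'M[R]_n)
    (Phi : set 'cV[R]_n) (Delta : seq 'cV[R]_n)
    (hW : finite_reflection_group W)
    (hPhi : root_system W Phi)
    (hDelta : simple_system Phi Delta)
    (w w' : 'M[R]_n) (hw : W w) (hw' : W w')
    (hreg : (reg Phi Delta w #= bruhat_ideal W Delta w)%card)
    (hreg' : card_lt (reg Phi Delta w') (bruhat_ideal W Delta w')) :
  ~ poset_isomorphic (bruhat_le W Delta) (bruhat_le W Delta)
      (bruhat_ideal W Delta w) (bruhat_ideal W Delta w').
Proof.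
move=> iso; have [l0 hl0] := height_exists hDelta.
have [P Pu PE] := @positive_roots_seq _ _ _ _ hW hPhi l0.
have [L hL] := inversion_seq_exists hW hPhi hDelta hl0 hw.
have [L' hL'] := inversion_seq_exists hW hPhi hDelta hl0 hw'.
(* It suffices that all of [[e, w']] consists of products, that is, that [w'] is geodesic; this
   property is carried over from [w], where the equality of cardinals yields it. *)
case: hreg' => _ /negP; apply.
apply: (card_ideal_le hW hPhi hDelta hl0 hw' hL').
apply: (geodesic_nbc hW hPhi hDelta hl0 hw' hL').
apply: (geodesic_iso hW hPhi hDelta hl0 Pu PE hw hw' iso) => u uI.
apply: (nbc_dpath hW hPhi hDelta hl0 hw hL).
exact: (ideal_nbc hW hPhi hDelta hl0 hw hL hreg).
Qed.
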